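(* Assume the $abc$-conjecture. Let $0<\varepsilon<1/2$. Then there exists a number $k_1$ depending only on $\varepsilon$ such that for all integers $k\ge k_1$ and all integers $n>k^{3/2}$ we have $$P(n,k)\ \ge\ \left(\tfrac12-\varepsilon\right)k\log n.$$
   Context: For a positive integer $x$, $P(x)$ denotes the greatest prime factor of $x$ (with $P(1)=1$) and $R(x)$ the greatest squarefree divisor (radical) of $x$, i.e. the product of the distinct primes dividing $x$. For positive integers $n,k$, $P(n,k)=P(N)$ where $N=n(n+1)\cdots(n+k-1)$. The $abc$-conjecture (Oesterl\'e and Masser) is the statement: for every $\varepsilon>0$ there is a constant $C_\varepsilon$ such that for all coprime positive integers $a,b,c$ with $a+b=c$ we have $c\le C_\varepsilon\,R(abc)^{1+\varepsilon}$. *)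

(* Defs.v *)
From mathcomp Require Import all_boot all_order all_algebra.
From mathcomp Require Import reals exp.
Set Implicit Arguments.
Unset Strict Implicit.
Unset Printing Implicit Defensive.
Import Order.TTheory GRing.Theory Num.Theory.
Local Open Scope ring_scope.

Definition radical (x : nat) : nat := (\prod_(p <- primes x) p)%N.

(* P(n, k), the greatest prime factor of n (n + 1) ... (n + k - 1);
   max_pdiv 1 = 1, in agreement with the convention P(1) = 1. *)
Definition max_pdiv_consecutive (n k : nat) : nat :=
  max_pdiv (\prod_(0 <= i < k) (n + i))%N.

Definition abc_conjecture (R : realType) : Prop :=
  forall eps : R, 0 < eps ->
  exists C : R, forall a b c : nat,
    (0 < a)%N -> (0 < b)%N -> (0 < c)%N ->
    coprime a b -> coprime a c -> coprime b c ->
    (a + b)%N = c ->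
    c%:R <= C * (radical (a * b * c))%:R `^ (1 + eps).

(* Main.v *)
Require Import Defs.
From mathcomp Require Import all_boot all_order all_algebra.
From mathcomp Require Import boolp reals topology normedtype derive sequences.
From mathcomp Require Import exp trigo.
From mathcomp Require Import zify ring lra.
Import Order.TTheory GRing.Theory Num.Theory.
Import numFieldNormedType.Exports.
Set Implicit Arguments.
Unset Strict Implicit.
Unset Printing Implicit Defensive.
Local Open Scope ring_scope.

(** Two ranges of n are treated by different means; in both the constant obtained is 1/2,
  slightly more than what is asked for. Write P for the greatest prime factor of
  n (n + 1) ... (n + k - 1).

  When n >= k ^ 1000, apply the abc conjecture to x (x + 2) + 1 = (x + 1) ^ 2: the radical
  of x (x + 1) (x + 2) is at least x ^ (2 - o(1)). About k / 3 disjoint triples fit in the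
  block, so their radicals contribute (2/3 - o(1)) k ln n to the sum of the ln p over the
  primes p <= P, counted once for each triple they meet. A prime meets at most one more
  triple than it has multiples among 1, ..., k, so this count exceeds theta P by at most
  k ln k, which is negligible here. Since theta P <= 1.3 P + O(1) by Chebyshev's method
  applied to (6m)! / (m! (2m)! (3m)!), and 2/3 > 1.3 / 2, this gives P >= k ln n / 2. Using
  triples rather than pairs is what makes a bound for theta weaker than the prime number
  theorem sufficient. This is [large_range].

  When k ^ (3/2) < n <= k ^ A, the stronger bound P >= C k ln k holds for every constant C
  and all large k, unconditionally ([middle_range]). The binomial coefficient
  C(n + k - 1, k) is at least (n / k) ^ k and its prime powers are at most n + k, so it has at
  least k / 4 prime factors, each with a multiple in [n, n + k). Suppose that they are all
  at most C k ln k. Chebyshev's bound shows that few of them are below a small multiple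
  Y of k ln k. A number d >= Y has a multiple in [n, n + k) only if n / d is within a
  constant times 1 / ln k of an integer. Fix a modulus M with totient M / M tiny: large primes
  occupy totient M of the classes modulo M, and in each class n / d is equidistributed
  modulo 1 on the scale 1 / ln k, so that only a small multiple of k primes can qualify.

  The equidistribution follows from estimates for sums of cos (2 pi j n / d) over
  arithmetic progressions of d, with a saving of a power of ln k. The differences of
  1 / d are explicit. If k ^ (q + 3/2) <= n <= k ^ (q + 5/2), the difference of order q + 2
  of n / d has size between about k ^ (- 3/2) and k ^ (- 1/2), up to powers of ln k; q steps
  of van der Corput's inequality reduce such a sum to one with second differences in that
  range, which is handled by linearization on short windows and geometric sums. *)

(** * Cosines of angles measured in turns *)

Lemma cos_lipschitz (R : realType) (x y : R) : `|cos x - cos y| <= `|x - y|.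
Proof.
wlog le_xy : x y / x <= y.
  by move=> wl; have [/wl//|/ltW/wl] := leP x y; rewrite distrC [`|y - x|]distrC.
rewrite distrC [`|x - y|]distrC.
have [|z _ ->] := MVT_segment le_xy (fun z _ => is_derive_cos z).
  exact/continuous_subspaceT/continuous_cos.
by rewrite normrM normrN ler_piMl // sin_max.
Qed.

(** Doubling the angle moves it to [0, pi/4], where the cosine is at least 1/sqrt 2. *)
Lemma sin_ge_half (R : realType) (y : R) : 0 <= y <= pi / 2 -> y / 2 <= sin y.
Proof.
move=> /andP[y0 ypi]; pose z := y / 2.
have z0 : 0 <= z by rewrite /z; lra.
have pi0 := @pi_gt0 R.
have cos_lb x : 0 <= x <= z -> 0 <= cos x /\ 1 / 2 <= cos x ^+ 2.
  move=> /andP[x0 xz].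
  have c2 : 0 <= cos (x *+ 2).
    by apply: cos_ge0_pihalf; rewrite (mulr2n x); rewrite /z in xz; apply/andP; split; lra.
  split; first by apply: cos_ge0_pihalf; rewrite /z in xz; apply/andP; split; lra.
  by move: c2; rewrite cos_mulr2n mulr2n; lra.
have [|x xz] := MVT_segment z0 (fun z _ => is_derive_sin z).
  exact/continuous_subspaceT/continuous_sin.
rewrite sin0 !subr0 => sz.
have -> : y = z *+ 2 by rewrite (mulr2n z) /z; lra.
rewrite sin_mulr2n sz.
have [cx0 cx] := cos_lb x xz.
have [cz0 cz] := cos_lb z ltac:(by rewrite z0 lexx).
have : 1 / 2 <= cos x * cos z.
  have c0 := mulr_ge0 cx0 cz0.
  rewrite leNgt; apply/negP => lt.
  have : (cos x * cos z) ^+ 2 < (1 / 2) ^+ 2 by rewrite ltr_pXn2r // nnegrE; lra.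
  have : 1 / 2 * (1 / 2) <= cos x ^+ 2 * cos z ^+ 2 by apply: ler_pM => //; lra.
  by rewrite exprMn expr2; lra.
by move=> ?; rewrite (mulr2n z) (mulr2n (_ * _)); nra.
Qed.

(** Angles are measured in turns, so that integers are periods and closeness to an
  integer is what matters. *)
Definition cos_turns (R : realType) (x : R) : R := cos (2 * pi * x).
Definition sin_turns (R : realType) (x : R) : R := sin (2 * pi * x).

Lemma cos_turns_le1 (R : realType) (x : R) : `|cos_turns x| <= 1.
Proof. exact: cos_max. Qed.

Lemma cos_turnsN (R : realType) (x : R) : cos_turns (- x) = cos_turns x.
Proof. by rewrite /cos_turns mulrN cosN. Qed.

Lemma cos_turnsB (R : realType) (x y : R) :
  cos_turns (x - y) = cos_turns x * cos_turns y + sin_turns x * sin_turns y.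
Proof. by rewrite /cos_turns /sin_turns mulrBr cosB. Qed.

Lemma cos_turns_int (R : realType) (x : R) (i : int) : cos_turns (x - i%:~R) = cos_turns x.
Proof.
have addn (n : nat) y : cos_turns (y + n%:R) = cos_turns y :> R.
  rewrite /cos_turns mulrDr -[RHS](periodicn (@cosD2pi R) n); congr cos.
  by rewrite -mulr_natr -mulr_natr; ring.
case: i => n; last by rewrite NegzE mulrNz opprK; exact: addn.
by rewrite -[LHS](addn n) -pmulrn subrK.
Qed.

Lemma cos_turns_lipschitz (R : realType) (x y : R) : `|cos_turns x - cos_turns y| <= 8 * `|x - y|.
Proof.
apply: (le_trans (cos_lipschitz _ _)).
have pi0 := @pi_gt0 R; have pi4 := @pihalf_lt2 R.
by rewrite -mulrBr normrM ler_wpM2r // ger0_norm; lra.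
Qed.

(** Telescoping 2 sin b cos (a + 2 b s) = sin (a + 2 b s + b) - sin (a + 2 b s - b). *)
Lemma geometric_cos_sum (R : realType) (a b : R) n :
  `|sin b| * `|\sum_(s < n) cos (a + 2 * b * s%:R)| <= 1.
Proof.
have -> : `|sin b| * `|\sum_(s < n) cos (a + 2 * b * s%:R)| =
    `|sin (a + 2 * b * n%:R - b) - sin (a - b)| / 2.
  rewrite -normrM -[X in _ = _ / X](@ger0_norm _ 2) // -normf_div; congr (`|_|).
  elim: n => [|n IH]; first by rewrite big_ord0 !mulr0 addr0 subrr mul0r.
  rewrite big_ord_recr /= mulrDr IH -(natr1 n).
  have -> : a + 2 * b * (n%:R + 1) - b = (a + 2 * b * n%:R) + b by ring.
  by rewrite (sinD _ b) (sinB _ b) (sinB a b); field.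
have := ler_normB (sin (a + 2 * b * n%:R - b)) (sin (a - b)).
by have := sin_max (a + 2 * b * n%:R - b); have := sin_max (a - b); lra.
Qed.

Definition nearest (R : realType) (x : R) : int := Num.floor (x + 1 / 2).

Lemma nearestP (R : realType) (x : R) : `|x - (nearest x)%:~R| <= 1 / 2.
Proof.
have /andP[] := floor_itv (x + 1 / 2); rewrite -/(nearest x) intrD => *.
by rewrite ler_norml; apply/andP; split; lra.
Qed.

(** With t the distance from b to the nearest integer, the right-hand side is sin (pi t)
  >= pi t / 2 >= t. *)
Lemma nearest_le_sin (R : realType) (b : R) :
  `|b - (nearest b)%:~R| <= `|sin (pi * b)|.
Proof.
set x := b - _.
have pi0 := @pi_gt0 R; have pi2 := @pi_ge2 R; have x2 := nearestP b.
have sin2 (y : R) : sin (pi * y) ^+ 2 = (1 - cos_turns y) / 2.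
  by rewrite /cos_turns -mulrA mulr_natl cos_mulr2n cos2sin2 mulr2n; lra.
have -> : `|sin (pi * b)| = sin (pi * `|x|).
  have s0 : 0 <= sin (pi * `|x|).
    apply: sin_ge0_pi; rewrite mulr_ge0 ?(ltW pi0) //= ler_piMr ?(ltW pi0) //.
    by rewrite -/x in x2; lra.
  apply/eqP; rewrite -(eqrXn2 (n := 2)) // real_normK ?num_real // !sin2.
  suff -> : cos_turns `|x| = cos_turns b by [].
  rewrite /x -(cos_turns_int b (nearest b)).
  by case: (ler0P (b - _)) => _; rewrite ?cos_turnsN.
have : pi * `|x| / 2 <= sin (pi * `|x|).
  apply: sin_ge_half; rewrite mulr_ge0 ?(ltW pi0) //=.
  by rewrite ler_wpM2l ?(ltW pi0) //; rewrite -/x in x2; lra.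
by have := normr_ge0 x; nra.
Qed.

Lemma linear_cos_turns_sum (R : realType) (a b nu : R) n : 0 < nu ->
  nu <= `|b - (nearest b)%:~R| ->
  `|\sum_(s < n) cos_turns (a + s%:R * b)| <= nu^-1.
Proof.
move=> nu0 far.
have := geometric_cos_sum (2 * pi * a) (pi * b) n.
rewrite (eq_bigr (fun s : 'I_n => cos_turns (a + s%:R * b))); last first.
  by move=> s _; congr cos; ring.
have := le_trans far (nearest_le_sin b) => le_nu le1.
rewrite -(ler_pM2l nu0) divff ?gt_eqF //; apply: le_trans le1.
by rewrite ler_wpM2r.
Qed.

(** * Sums with a controlled second difference *)

Definition fdiff (R : zmodType) (f : nat -> R) (t : nat) : R := f t.+1 - f t.

Lemma sum_fdiff (R : zmodType) (f : nat -> R) a h :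
  \sum_(j < h) fdiff f (a + j) = f (a + h)%N - f a.
Proof.
elim: h => [|h IH]; first by rewrite big_ord0 addn0 subrr.
by rewrite big_ord_recr /= IH /fdiff addnS addrC subrKA.
Qed.

Lemma norm_sum_le (R : realType) n (F : 'I_n -> R) (b : R) :
  (forall s, `|F s| <= b) -> `|\sum_(s < n) F s| <= n%:R * b.
Proof.
move=> Fb; apply: le_trans (ler_norm_sum _ _ _) _.
apply: le_trans (ler_sum _ (fun s _ => Fb s)) _.
by rewrite sumr_const card_ord mulr_natl.
Qed.

Lemma shift_sum_le (R : realType) (c : nat -> R) T h :
  (forall t, `|c t| <= 1) ->
  `|\sum_(t < T) c (t + h)%N - \sum_(t < T) c t| <= 2 * h%:R.
Proof.
move=> c1; elim: h => [|h IH].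
  by under eq_bigr do rewrite addn0; rewrite subrr normr0 mulr0.
have -> : \sum_(t < T) c (t + h.+1)%N = \sum_(t < T) c (t + h)%N + (c (T + h)%N - c h).
  rewrite -(sum_fdiff (fun t => c (t + h)%N) 0 T) -big_split /=.
  by apply: eq_bigr => t _; rewrite /fdiff add0n addrC subrK addSnnS.
rewrite addrAC -(natr1 h) mulrDr mulr1.
apply: le_trans (ler_normD _ _) _; apply: lerD IH _.
by apply: le_trans (ler_normB _ _) _; have := c1 (T + h)%N; have := c1 h; lra.
Qed.

(** Each of the H shifted copies of the sum differs from it in at most H terms at either
  end. *)
Lemma shift_average (R : realType) (c : nat -> R) T H :
  (forall t, `|c t| <= 1) -> (0 < H)%N ->
  `|\sum_(t < T) c t| <= 2 * H%:R + `|\sum_(t < T) \sum_(h < H) c (t + h)%N| / H%:R.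
Proof.
move=> c1 H0; have H0r : 0 < H%:R :> R by rewrite ltr0n.
rewrite -lerBlDr -(ler_pM2r H0r) mulrBl divfK ?gt_eqF // lerBlDr -lerBlDl.
set S := \sum_(t < T) c t; set SS := \sum_(t < T) _.
have eqS : S * H%:R = \sum_(h < H) S.
  by rewrite sumr_const card_ord mulr_natr.
have : `|SS - S * H%:R| <= \sum_(h < H) 2 * H%:R.
  rewrite eqS /SS exchange_big /= -sumrB; apply: le_trans (ler_norm_sum _ _ _) _.
  apply: ler_sum => h _; apply: le_trans (shift_sum_le _ _ c1) _.
  by rewrite ler_pM2l // ler_nat ltnW.
rewrite sumr_const card_ord -(mulr_natr (2 * _)).
have -> : `|S| * H%:R = `|S * H%:R| by rewrite normrM (ger0_norm (ltW H0r)).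
by have := lerB_dist (S * H%:R) SS; rewrite distrC; lra.
Qed.

Lemma linearization (R : realType) (f : nat -> R) (mu : R) t l s :
  (forall j, (j < l)%N -> 0 <= fdiff (fdiff f) (t + j) <= mu) -> (s <= l)%N ->
  `|f (t + s)%N - (f t + s%:R * fdiff f t)| <= s%:R ^+ 2 * mu.
Proof.
move=> d2; have d1 j : (j <= l)%N -> 0 <= fdiff f (t + j) - fdiff f t <= j%:R * mu.
  elim: j => [|j IH] jl; first by rewrite addn0 subrr mul0r lexx.
  have := d2 j jl; have := IH (ltnW jl).
  rewrite -[fdiff (fdiff f) _]/(fdiff f (t + j).+1 - fdiff f (t + j)).
  by rewrite addnS -(natr1 j); lra.
elim: s => [|s IH] sl.
  by rewrite addn0 mul0r addr0 subrr normr0 expr2 !mul0r.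
have := IH (ltnW sl); have := d1 s (ltnW sl); rewrite addnS -(natr1 s).
have : f (t + s).+1 = f (t + s)%N + fdiff f (t + s) by rewrite /fdiff addrC subrK.
move=> ->; rewrite !ler_norml; set x := s%:R; have x0 : 0 <= x by rewrite ler0n.
move=> /andP[? ?] /andP[? ?]; have m0 : 0 <= x * mu by lra.
have mu0 : 0 <= mu by have /andP[] := d2 s sl; apply: le_trans.
by apply/andP; split; nra.
Qed.

Lemma card_le_diameter (R : realType) T (A : {set 'I_T}) (B : R) : 0 <= B ->
  (forall t u : 'I_T, t \in A -> u \in A -> (t <= u)%N -> (u - t)%N%:R <= B) ->
  #|A|%:R <= B + 1.
Proof.
move=> B0 diam; have [->|[t0 t0A]] := set_0Vmem A; first by rewrite cards0; lra.
case: (arg_minnP (fun t : 'I_T => nat_of_ord t) t0A) => m mA m_min.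
pose g (t : 'I_T) : 'I_(Num.truncn B).+1 := inord (t - m).
have gE t : t \in A -> g t = (t - m)%N :> nat.
  move=> tA; rewrite /g inordK // ltnS truncn_ge_nat //.
  exact: diam (m_min _ tA).
have <- : #|[set g t | t in A]| = #|A|.
  apply: card_in_imset => t u tA uA /(congr1 val) /=; rewrite !gE // => eq.
  apply/ord_inj; have := m_min _ tA; have := m_min _ uA; clear -eq; lia.
apply: le_trans (_ : (Num.truncn B).+1%:R <= _).
  by rewrite ler_nat; apply: leq_trans (max_card _) _; rewrite card_ord.
by rewrite -(natr1 (Num.truncn _)) lerD2r truncn_le.
Qed.

(** The integers nearest to the values run over an interval of length about T * Lam, and
  the terms close to one given integer lie in a window of diameter 2 nu / lam. *)
Lemma card_near_integer (R : realType) (b : nat -> R) T (lam Lam nu : R) :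
  0 < lam -> 0 < nu -> (forall t, (t < T)%N -> lam <= fdiff b t <= Lam) ->
  #|[set t : 'I_T | `|b t - (nearest (b t))%:~R| < nu]|%:R
    <= (T%:R * Lam + 2) * (2 * nu / lam + 1).
Proof.
move=> lam0 nu0 db.
have q0 : 0 <= 2 * nu / lam by apply: divr_ge0; [apply: mulr_ge0|]; lra.
have [->|T0] := posnP T.
  rewrite (_ : [set _ | _] = finset.set0) ?cards0; last by apply/setP => -[].
  by rewrite mul0r add0r mulr_ge0 // addr_ge0.
have Lam0 : 0 <= Lam by have := db 0%N T0; lra.
have mono t u : (t <= u)%N -> (u <= T)%N ->
    (u - t)%:R * lam <= b u - b t <= (u - t)%:R * Lam.
  move=> tu uT; have sumE (x : R) : (u - t)%:R * x = \sum_(j < u - t) x.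
    by rewrite sumr_const card_ord mulr_natl.
  have := sum_fdiff b t (u - t); rewrite (subnKC tu) => <-; rewrite !sumE.
  by apply/andP; split; apply: ler_sum => j _;
    case/andP: (db (t + j)%N ltac:(have := ltn_ord j; lia)).
have i_mono t : (t < T)%N -> 0 <= nearest (b t) - nearest (b 0%N) :> int.
  move=> tT; rewrite subr_ge0 /nearest; apply: le_floor; rewrite lerD2r.
  have := mono 0%N t isT (ltnW tT); rewrite subn0.
  have : 0 <= t%:R * lam by rewrite mulr_ge0 // ltW.
  lra.
set N := (Num.truncn (T%:R * Lam + 1)).+1.
have TL0 : 0 <= T%:R * Lam by rewrite mulr_ge0 ?ler0n.
have N_le : N%:R <= T%:R * Lam + 2.
  by rewrite -(natr1 (Num.truncn _)); have := truncn_le (T%:R * Lam + 1); rewrite addr_ge0 // => ?; lra.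
pose u (t : 'I_T) : 'I_N := inord `|nearest (b t) - nearest (b 0%N)|%N.
have uE t : u t = `|nearest (b t) - nearest (b 0%N)|%N :> nat.
  rewrite /u inordK // ltnS truncn_ge_nat; last lra.
  have ge0 := i_mono t (ltn_ord t).
  rewrite -[_%:R]/((Posz `|_|)%:~R) gez0_abs // intrB.
  have /andP[_] := mono 0%N t isT (ltnW (ltn_ord t)); rewrite subn0.
  have := nearestP (b t); have := nearestP (b 0%N); rewrite !ler_norml.
  move=> /andP[? ?] /andP[? ?] ?.
  have : t%:R * Lam <= T%:R * Lam by rewrite ler_wpM2r // ler_nat ltnW.
  by lra.
set A := [set t | _].
have -> : #|A| = (\sum_(v < N) #|[set t in A | u t == v]|)%N.
  rewrite -sum1_card (partition_big u xpredT) //=; apply: eq_bigr => v _.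
  by rewrite -sum1_card; apply: eq_bigl => t; rewrite inE.
have fib (v : 'I_N) : #|[set t in A | u t == v]|%:R <= 2 * nu / lam + 1.
  apply: card_le_diameter => [//|t s].
  rewrite !inE => /andP[tA /eqP ut] /andP[sA /eqP us] ts.
  have eq_i : nearest (b t) = nearest (b s).
    have := uE t; rewrite ut -us uE => /eqP.
    have := i_mono t (ltn_ord t); have := i_mono s (ltn_ord s).
    by lia.
  have := mono _ _ ts (ltnW (ltn_ord s)) => /andP[le_s _].
  rewrite ler_pdivlMr //; apply: le_trans le_s _.
  by move: tA sA; rewrite eq_i !ltr_norml => /andP[? ?] /andP[? ?]; lra.
rewrite natr_sum; apply: le_trans (ler_sum _ (fun v _ => fib v)) _.
by rewrite sumr_const card_ord -(mulr_natl (_ + 1)) ler_wpM2r // addr_ge0.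
Qed.

(** Windows of length l are short enough for f to be linear up to an error C lam l ^ 2, and
  the geometric sums over them are small unless the slope is within nu of an integer. *)
Lemma second_difference_bound (R : realType) (f : nat -> R) T l (lam C nu : R) :
  0 < lam -> 0 < nu -> (0 < l <= T)%N ->
  (forall t, (t < T + l)%N -> lam <= fdiff (fdiff f) t <= C * lam) ->
  `|\sum_(t < T) cos_turns (f t)| <= 2 * l%:R + T%:R * (8 * C * lam * l%:R ^+ 2)
     + T%:R / (nu * l%:R) + (T%:R * (C * lam) + 2) * (2 * nu / lam + 1).
Proof.
move=> lam0 nu0 /andP[l0 lT] d2.
have l0r : 0 < l%:R :> R by rewrite ltr0n.
have Cl0 : 0 <= C * lam by have := d2 0%N ltac:(lia); lra.
apply: le_trans (shift_average T (fun t => cos_turns_le1 (f t)) l0) _.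
rewrite -!addrA lerD2l ler_pdivrMr //.
pose A := [set t : 'I_T | `|fdiff f t - (nearest (fdiff f t))%:~R| < nu].
have inner (t : 'I_T) : `|\sum_(s < l) cos_turns (f (t + s)%N)|
    <= l%:R * (8 * (l%:R ^+ 2 * (C * lam))) + nu^-1 + l%:R * (t \in A)%:R.
  have lin : `|\sum_(s < l) cos_turns (f (t + s)%N) - \sum_(s < l) cos_turns (f t + s%:R * fdiff f t)|
      <= l%:R * (8 * (l%:R ^+ 2 * (C * lam))).
    rewrite -sumrB; apply: norm_sum_le => s.
    apply: le_trans (cos_turns_lipschitz _ _) _; rewrite ler_wpM2l //.
    apply: le_trans (_ : s%:R ^+ 2 * (C * lam) <= _).
      apply: (linearization (l := l)) => [j jl|]; last exact: ltnW.
      have /andP[? ?] := d2 (t + j)%N ltac:(have := ltn_ord t; lia).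
      by apply/andP; split; lra.
    by rewrite ler_wpM2r // lerXn2r ?nnegrE ?ler0n // ler_nat ltnW.
  have main : `|\sum_(s < l) cos_turns (f t + s%:R * fdiff f t)| <= nu^-1 + l%:R * (t \in A)%:R.
    rewrite inE; case: ltP => [_|far].
      rewrite mulr1; apply: le_trans (_ : l%:R <= _); last by rewrite lerDr invr_ge0 ltW.
      by rewrite -[l%:R]mulr1; apply: norm_sum_le => s; apply: cos_turns_le1.
    by rewrite mulr0 addr0; exact: linear_cos_turns_sum.
  have := ler_normD (\sum_(s < l) cos_turns (f (t + s)%N) - \sum_(s < l) cos_turns (f t + s%:R * fdiff f t))
    (\sum_(s < l) cos_turns (f t + s%:R * fdiff f t)).
  by rewrite subrK; lra.
have count : #|A|%:R <= (T%:R * (C * lam) + 2) * (2 * nu / lam + 1).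
  by apply: card_near_integer => // t tT; apply: d2; lia.
apply: le_trans (ler_norm_sum _ _ _) _; apply: le_trans (ler_sum _ (fun t _ => inner t)) _.
rewrite big_split /= sumr_const card_ord -mulr_sumr -natr_sum -(mulr_natl (_ + _)).
rewrite -big_mkcond sum1_card invfM.
have -> : (T%:R * (8 * C * lam * l%:R ^+ 2) +
   (T%:R * (nu^-1 / l%:R) + (T%:R * (C * lam) + 2) * (2 * nu / lam + 1))) * l%:R =
   T%:R * (l%:R * (8 * (l%:R ^+ 2 * (C * lam))) + nu^-1) +
   l%:R * ((T%:R * (C * lam) + 2) * (2 * nu / lam + 1)).
  by field; rewrite !gt_eqF.
by rewrite lerD2l ler_pM2l.
Qed.

Lemma ler_of_sqr (R : realDomainType) (x y : R) : 0 <= y -> x ^+ 2 <= y ^+ 2 -> x <= y.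
Proof.
move=> y0 xy; rewrite leNgt; apply/negP => lt_yx.
by have : y ^+ 2 < x ^+ 2; [rewrite ltrXn2r ?nnegrE //; lra|lra].
Qed.

(** The arithmetic of the choice of window length y and closeness nu = 8 w / y.
  Linearization costs C lam y ^ 2, the geometric sums cost 1 / (nu y), and the
  exceptional slopes have density about nu; taking y of the order of (C w lam) ^ (- 1/2)
  makes each of them at most a fraction of 1 / w as long as lam is neither too large nor
  too close to 1 / X ^ 2. *)
Lemma optimal_window_bound (R : realType) (C w lam X y : R) :
  1 <= C -> 1 <= w -> 0 < lam -> 0 <= X -> 1 <= y ->
  256 ^+ 3 * C ^+ 3 * w ^+ 5 <= lam * X ^+ 2 ->
  lam * (256 ^+ 3 * C ^+ 3 * w ^+ 5) <= 1 ->
  64 * (lam * (C * w)) * y ^+ 2 <= 1 -> 1 <= 256 * (lam * (C * w)) * y ^+ 2 ->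
  16 * (w * y) <= X /\
  2 * y + X * (8 * C * lam * y ^+ 2) + X / (8 * w / y * y)
    + (X * (C * lam) + 2) * (2 * (8 * w / y) / lam + 1) <= X / w.
Proof.
move=> C1 w1 lam0 X0 y1 hA hlam y_le y_ge.
have C0 : 0 < C by lra.
have w0 : 0 < w by lra.
have y0 : 0 < y by lra.
have CC : C <= C ^+ 3 by rewrite -[leLHS]expr1 ler_weXn2l.
have ww : w <= w ^+ 5 by rewrite -[leLHS]expr1 ler_weXn2l.
have p3 : 0 < 256 ^+ 3 :> R by rewrite exprn_gt0 // ltr0n.
have Kw : 256 ^+ 3 * C * w ^+ 5 <= 256 ^+ 3 * C ^+ 3 * w ^+ 5.
  by rewrite ler_pM2r ?ler_pM2l // exprn_gt0.
have big : 256 ^+ 3 * (C * w) <= 256 ^+ 3 * C ^+ 3 * w ^+ 5.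
  by apply: le_trans Kw; rewrite -mulrA !ler_pM2l.
have Cw0 : 0 < C * w by rewrite mulr_gt0.
have w_Cw : w <= C * w by rewrite ler_peMl // ltW.
have n256 : 256 <= 256 ^+ 3 :> R.
  by rewrite -[leLHS]expr1 ler_weXn2l //; clear; lra.
have small : lam * (256 * (C * w)) <= 1.
  apply: le_trans hlam; rewrite ler_pM2l //; apply: le_trans big.
  by rewrite ler_pM2r.
have lCw0 : 0 < lam * (C * w) by rewrite mulr_gt0.
have wT : 16 * (w * y) <= X.
  apply: ler_of_sqr => //; rewrite -(ler_pM2l lam0); apply: le_trans hA.
  apply: le_trans big.
  have -> : lam * (16 * (w * y)) ^+ 2 = 4 * w * (64 * (lam * (C * w)) * y ^+ 2) / C.
    by field; rewrite gt_eqF.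
  rewrite ler_pdivrMr //; apply: le_trans (_ : 256 * (C * w) <= _).
    apply: le_trans (_ : 4 * w <= _); last by clear -w_Cw w0; lra.
    by rewrite ler_piMr //; clear -w0; lra.
  apply: le_trans (_ : 256 ^+ 3 * (C * w) <= _); first by rewrite ler_pM2r.
  by rewrite ler_peMr // mulr_ge0 ?exprn_ge0 // ltW.
split=> //.
have bnd_b : 64 * (C * lam * y ^+ 2) * w <= 1.
  by apply: le_trans y_le; rewrite le_eqVlt; apply/orP; left; apply/eqP; ring.
have bnd_d1 : 128 * C * w ^+ 2 <= y.
  apply: ler_of_sqr; first exact: ltW.
  have l256 : 0 < 256 * (lam * (C * w)) by rewrite mulr_gt0.
  rewrite -(ler_pM2l l256); apply: le_trans y_ge; apply: le_trans hlam.
  have -> : 256 * (lam * (C * w)) * (128 * C * w ^+ 2) ^+ 2 =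
    lam * (256 * 128 ^+ 2 * C ^+ 3 * w ^+ 5) by ring.
  by rewrite ler_pM2l // !ler_pM2r ?exprn_gt0 //; clear; lra.
have bnd_d2 : 256 * w ^+ 2 <= y * (lam * X).
  apply: ler_of_sqr; first by rewrite !mulr_ge0 // ltW.
  have Cw256 : 0 < 256 * (C * w) by rewrite mulr_gt0.
  rewrite -(ler_pM2l Cw256).
  have -> : 256 * (C * w) * (y * (lam * X)) ^+ 2 =
      256 * (lam * (C * w)) * y ^+ 2 * (lam * X ^+ 2) by ring.
  apply: le_trans (_ : 1 * (lam * X ^+ 2) <= _).
    rewrite mul1r; apply: le_trans hA; apply: le_trans Kw.
    by rewrite le_eqVlt; apply/orP; left; apply/eqP; ring.
  by rewrite ler_wpM2r // mulr_ge0 ?sqr_ge0 // ltW.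
have bnd_d3 : C * lam * w * 256 <= 1.
  by apply: le_trans small; rewrite le_eqVlt; apply/orP; left; apply/eqP; ring.
rewrite ler_pdivlMr //.
have -> : (2 * y + X * (8 * C * lam * y ^+ 2) + X / (8 * w / y * y)
    + (X * (C * lam) + 2) * (2 * (8 * w / y) / lam + 1)) * w =
  16 * (w * y) / 8 + X * (64 * (C * lam * y ^+ 2) * w) / 8 + X / 8
   + (X * (128 * C * w ^+ 2 / y) / 8 + X * (C * lam * w * 256) / 256
    + 256 * w ^+ 2 / (y * lam) / 8 + 2 * w).
  by field; rewrite !gt_eqF.
have e1 : X * (128 * C * w ^+ 2 / y) <= X by rewrite ler_piMr // ler_pdivrMr // mul1r.
have e2 : 256 * w ^+ 2 / (y * lam) <= X by rewrite ler_pdivrMr ?mulr_gt0 // (mulrC X) -mulrA.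
have e3 := ler_piMr X0 bnd_b; have e4 := ler_piMr X0 bnd_d3.
have e5 : w <= w * y by rewrite ler_peMr // ltW.
by clear -wT e1 e2 e3 e4 e5 X0; lra.
Qed.

(** The window length is the largest one for which linearization is affordable. *)
Lemma second_difference_test (R : realType) (C : R) T W (lam : R) (f : nat -> R) :
  1 <= C -> (0 < W)%N -> 0 < lam ->
  256 ^+ 3 * C ^+ 3 * W%:R ^+ 5 <= lam * T%:R ^+ 2 ->
  lam * (256 ^+ 3 * C ^+ 3 * W%:R ^+ 5) <= 1 ->
  (forall t, (t < 2 * T)%N -> lam <= fdiff (fdiff f) t <= C * lam) ->
  `|\sum_(t < T) cos_turns (f t)| <= T%:R / W%:R.
Proof.
move=> C1 W0 lam0 hA hlam d2.
have w1 : 1 <= W%:R :> R by rewrite -[1]/(1%:R) ler_nat.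
have C0 : 0 < C by lra.
have w0 : 0 < W%:R :> R by lra.
pose s := 64 * (lam * (C * W%:R)).
have s0 : 0 < s by rewrite /s !mulr_gt0.
have s1 : s <= 1.
  apply: le_trans hlam; rewrite /s mulrCA ler_pM2l // mulrA.
  apply: ler_pM; rewrite ?mulr_ge0 ?(ltW C0) ?(ltW w0) //.
    apply: ler_pM; rewrite ?(ltW C0) //; first by clear; lra.
    by rewrite -[leLHS]expr1 ler_weXn2l.
  by rewrite -[leLHS]expr1 ler_weXn2l.
pose l := Num.truncn (Num.sqrt s^-1).
have sqrt1 : 1 <= Num.sqrt s^-1.
  by rewrite -[leLHS]sqrtr1 ler_wsqrtr // invf_ge1.
have l1 : (0 < l)%N by rewrite truncn_gt0.
have l1r : 1 <= l%:R :> R by rewrite -[1]/(1%:R) ler_nat.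
have /andP[l_le l_lt] := truncn_itv (le_trans ler01 sqrt1).
rewrite -/l -(natr1 l) in l_le l_lt.
have sqr : Num.sqrt s^-1 ^+ 2 = s^-1 by rewrite sqr_sqrtr // invr_ge0 ltW.
have sl1 : s * l%:R ^+ 2 <= 1.
  by rewrite mulrC -ler_pdivlMr // div1r -sqr ler_pXn2r ?nnegrE // (le_trans ler01).
have sl2 : 1 <= 256 * (lam * (C * W%:R)) * l%:R ^+ 2.
  have : s^-1 <= (2 * l%:R) ^+ 2.
    by rewrite -sqr ler_pXn2r ?nnegrE //; clear -l_lt l1r sqrt1; lra.
  rewrite -[s^-1]div1r ler_pdivrMr // => /le_trans; apply.
  by rewrite le_eqVlt; apply/orP; left; apply/eqP; rewrite /s; ring.
have [wT bound] := optimal_window_bound C1 w1 lam0 (ler0n _ T) l1r hA hlam sl1 sl2.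
have lT : (l <= T)%N.
  rewrite -(ler_nat R); apply: le_trans wT.
  by clear -w1 l1r; nra.
apply: le_trans bound; apply: second_difference_bound => //.
- by rewrite divr_gt0 ?mulr_gt0 // (lt_le_trans ltr01).
- by rewrite l1.
- by move=> t tT; apply: d2; clear -tT lT; lia.
Qed.

(** * Higher differences: the van der Corput method *)

Lemma sqr_sum_le (R : realType) T (u : 'I_T -> R) :
  (\sum_t u t) ^+ 2 <= T%:R * \sum_t u t ^+ 2.
Proof.
have [T0|T0] := posnP T.
  by subst T; rewrite !big_ord0 expr2 !mul0r.
set S := \sum_t u t; set Q := \sum_t u t ^+ 2.
have T0r : 0 < T%:R :> R by rewrite ltr0n.
have : 0 <= \sum_t (T%:R * u t - S) ^+ 2 by apply: sumr_ge0 => t _; apply: sqr_ge0.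
have -> : \sum_t (T%:R * u t - S) ^+ 2 = T%:R * (T%:R * Q - S ^+ 2).
  rewrite (eq_bigr (fun t => T%:R ^+ 2 * u t ^+ 2 + (- 2 * T%:R * S) * u t + S ^+ 2));
    last by move=> t _; ring.
  rewrite !big_split /= sumr_const card_ord -!mulr_sumr -/S -/Q -mulr_natl; ring.
by rewrite pmulr_rge0 // subr_ge0.
Qed.

(** The van der Corput inequality: after averaging over H shifts, Cauchy's inequality leaves
  only correlations of the sequence with its own translates. *)
Lemma van_der_corput (R : realType) (f : nat -> R) T H (B D : R) : (0 < H)%N -> 0 <= B -> 0 <= D ->
  (forall a h, (0 < h)%N -> (a + h < H)%N ->
    `|\sum_(t < T) cos_turns (f (t + a + h)%N - f (t + a)%N)| <= B) ->
  T%:R ^+ 2 / H%:R + T%:R * B <= D ^+ 2 ->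
  `|\sum_(t < T) cos_turns (f t)| <= 2 * H%:R + D.
Proof.
move=> H0 B0 D0 corr le_D.
have H0r : 0 < H%:R :> R by rewrite ltr0n.
have X0 : 0 <= T%:R :> R by [].
apply: le_trans (shift_average T (fun t => cos_turns_le1 (f t)) H0) _; rewrite lerD2l.
rewrite ler_pdivrMr //; apply: ler_of_sqr; first by rewrite mulr_ge0 // ltW.
rewrite real_normK ?num_real //.
apply: le_trans (sqr_sum_le _) _; rewrite exprMn.
apply: le_trans (_ : (T%:R ^+ 2 / H%:R + T%:R * B) * H%:R ^+ 2 <= _); last first.
  by rewrite ler_wpM2r // exprn_ge0 // ltW.
have -> : (T%:R ^+ 2 / H%:R + T%:R * B) * H%:R ^+ 2 = T%:R * (H%:R * (T%:R + H%:R * B)).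
  by field; rewrite gt_eqF.
rewrite ler_wpM2l //.
apply: le_trans (_ : \sum_(t < T) \sum_(h < H) \sum_(g < H)
   cos_turns (f (t + h)%N - f (t + g)%N) <= _).
  apply: ler_sum => t _.
  have -> : \sum_(h < H) \sum_(g < H) cos_turns (f (t + h)%N - f (t + g)%N) =
      (\sum_(h < H) cos_turns (f (t + h)%N)) ^+ 2 + (\sum_(h < H) sin_turns (f (t + h)%N)) ^+ 2.
    rewrite !expr2 !big_distrlr -big_split /=; apply: eq_bigr => h _.
    by rewrite -big_split /=; apply: eq_bigr => g _; rewrite cos_turnsB.
  by rewrite lerDl sqr_ge0.
rewrite exchange_big /=; under eq_bigr => h _ do rewrite exchange_big /=.
apply: le_trans (ler_norm _) _; apply: norm_sum_le => h.
rewrite (bigD1 h) //=; apply: le_trans (ler_normD _ _) _; apply: lerD.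
  by rewrite -[leRHS]mulr1; apply: norm_sum_le => t; apply: cos_turns_le1.
apply: le_trans (ler_norm_sum _ _ _) _.
apply: le_trans (_ : \sum_(g < H) B <= _); last by rewrite sumr_const card_ord mulr_natl.
rewrite big_mkcond; apply: ler_sum => g _; case: eqP => //= /eqP neq.
have [lt|ge] := ltnP h g.
  rewrite (eq_bigr (fun t : 'I_T => cos_turns (f (t + h + (g - h))%N - f (t + h)%N))).
    by apply: corr; have := ltn_ord g; lia.
  by move=> t _; rewrite -addnA (subnKC (ltnW lt)) -cos_turnsN opprB.
rewrite (eq_bigr (fun t : 'I_T => cos_turns (f (t + g + (h - g))%N - f (t + g)%N))).
  by apply: corr; have := ltn_ord h; rewrite -(inj_eq val_inj) /= in neq; lia.
by move=> t _; rewrite -addnA (subnKC ge).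
Qed.

Lemma iter_fdiff_shift (R : realType) m (f : nat -> R) a h t :
  iter m (@fdiff R) (fun s => f (s + a + h)%N - f (s + a)%N) t =
    \sum_(j < h) iter m.+1 (@fdiff R) f (t + a + j)%N.
Proof.
elim: m t => [|m IH] t /=; first by rewrite sum_fdiff.
by rewrite {1}/fdiff !IH -sumrB; apply: eq_bigr => j _; rewrite {3}/fdiff !addSn.
Qed.

(** By induction on q. A van der Corput step with H = 16 W ^ 2 shifts replaces a
  function by its increments over steps h < H, whose differences of one order less are
  about h times the original ones; the saving W ^ 2 for the increments, square-rooted,
  is the saving W for the function. *)
Lemma higher_difference_test (R : realType) (C : R) q : 1 <= C ->
  exists (K : R) (e : nat), [/\ 64 <= K, (3 <= e)%N &
  forall T W (lam : R) (f : nat -> R), (0 < W)%N -> 0 < lam ->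
    K * W%:R ^+ e <= lam * T%:R ^+ 2 -> lam * (K * W%:R ^+ e) <= 1 ->
    (forall t, (t < q.+2 * T)%N -> lam <= iter q.+2 (@fdiff R) f t <= C * lam) ->
    `|\sum_(t < T) cos_turns (f t)| <= T%:R / W%:R].
Proof.
move=> C1; elim: q => [|q [K [e [K64 e3 IH]]]].
  exists (256 ^+ 3 * C ^+ 3), 5; split=> //; last first.
    by move=> T W lam f W0 lam0 h1 h2 h3; apply: (second_difference_test C1 W0 lam0).
  have : 1 <= C ^+ 3 by rewrite exprn_ege1.
  lra.
exists (K * 16 ^+ e.+1), (2 * e + 3)%N; split; last 1 first.
- move=> T W lam f W0 lam0 hA hlam df.
  set w := W%:R in hA hlam *; have w1 : 1 <= w by rewrite -[1]/(1%:R) ler_nat.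
  set X := T%:R in hA *; have X0 : 0 <= X by rewrite ler0n.
  pose H := (16 * W ^ 2)%N.
  have HE : H%:R = 16 * w ^+ 2 by rewrite natrM natrX.
  have Kpos : 0 < K by lra.
  have e1 : 16 <= 16 ^+ e.+1 :> R.
    by rewrite -[leLHS]expr1 ler_weXn2l //; lra.
  have w3 : w ^+ 3 <= w ^+ (2 * e + 3) by rewrite ler_weXn2l // leq_addl.
  have w31 : 1 <= w ^+ 3 by rewrite exprn_ege1.
  have wbig : 64 * w ^+ 3 <= K * 16 ^+ e.+1 * w ^+ (2 * e + 3).
    apply: ler_pM => //; first by lra.
    by rewrite (le_trans K64) // ler_peMr //; lra.
  (* multiplied together, the two bounds on lam bound T from below *)
  have T_big : 64 * w ^+ 3 <= X.
    apply: ler_of_sqr => //; set Z := K * _ * _ in hA hlam wbig.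
    have Z0 : 0 < Z by lra.
    apply: le_trans (_ : Z ^+ 2 <= _); first by rewrite lerXn2r ?nnegrE //; lra.
    have := ler_wpM2r (ltW Z0) hA; have := ler_wpM2r (sqr_ge0 X) hlam.
    by rewrite expr2; lra.
  have HT : (H <= T)%N.
    rewrite -(ler_nat R) HE -/X; apply: le_trans T_big.
    have : w ^+ 2 <= w ^+ 3 by rewrite ler_weXn2l.
    by have := sqr_ge0 w; lra.
  have X0' : 0 < X by lra.
  apply: le_trans (van_der_corput (H := H) (B := X / H%:R) (D := X / (2 * w)) _ _ _ _ _) _.
  + by rewrite /H muln_gt0 expn_gt0 W0.
  + by rewrite divr_ge0.
  + by rewrite divr_ge0 //; lra.
  + move=> a h h0 ahH.
    have h1 : 1 <= h%:R :> R by rewrite -[1]/(1%:R) ler_nat.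
    have hH : h%:R <= H%:R :> R.
      by rewrite ler_nat ltnW //; apply: leq_trans ahH; rewrite ltnS leq_addl.
    have H1 : 1 <= H%:R := le_trans h1 hH.
    have He : K * H%:R ^+ e.+1 <= K * 16 ^+ e.+1 * w ^+ (2 * e + 3).
      rewrite HE exprMn -exprM mulrA; apply: ler_wpM2l; first by rewrite mulr_ge0 //; lra.
      by rewrite ler_weXn2l //; clear; lia.
    have He' : K * H%:R ^+ e <= K * H%:R ^+ e.+1.
      by rewrite ler_pM2l // ler_weXn2l.
    apply: (IH T H (h%:R * lam) (fun t => f (t + a + h)%N - f (t + a)%N)).
    * by rewrite /H muln_gt0 expn_gt0 W0.
    * by rewrite mulr_gt0 //; lra.
    * rewrite -/X -mulrA; apply: le_trans (_ : lam * X ^+ 2 <= _); first lra.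
      by rewrite ler_peMl // mulr_ge0 ?sqr_ge0 // ltW.
    * apply: le_trans hlam; rewrite mulrAC mulrC ler_wpM2l ?(ltW lam0) //.
      apply: le_trans He; rewrite exprS mulrCA ler_pM2l //.
      by rewrite ler_wpM2r // exprn_ge0.
    * move=> t tT; rewrite iter_fdiff_shift.
      have sumE (x : R) : h%:R * x = \sum_(j < h) x by rewrite sumr_const card_ord mulr_natl.
      rewrite mulrCA !sumE; apply/andP; split; apply: ler_sum => j _;
      by have /andP[] := df (t + a + j)%N ltac:(have := ltn_ord j; clear -ahH HT tT; nia).
  + rewrite -/X HE.
    have -> : X ^+ 2 / (16 * w ^+ 2) + X * (X / (16 * w ^+ 2)) = X ^+ 2 / w ^+ 2 / 8.
      by field; lra.
    have -> : (X / (2 * w)) ^+ 2 = X ^+ 2 / w ^+ 2 / 4 by field; lra.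
    have : 0 <= X ^+ 2 / w ^+ 2 by rewrite divr_ge0 ?sqr_ge0.
    lra.
  rewrite HE; have -> : X / (2 * w) = X / w / 2 by field; lra.
  suff : 64 * w ^+ 2 <= X / w by lra.
  by rewrite ler_pdivlMr; [rewrite -mulrA -exprSr|lra].
- rewrite (le_trans K64) // ler_peMr //; first lra.
  by rewrite exprn_ege1 //; lra.
- lia.
Qed.

(** * Integers with a multiple in a short interval *)

(** A Fejer-type majorant: the squared modulus of the exponential polynomial of length H is
  at least (H / 2) ^ 2 near the integers, and its mean over t is governed by the sums. *)
Lemma card_close_to_integer (R : realType) (g : nat -> R) T H (A : {set 'I_T}) : (0 < H)%N ->
  (forall j, (0 < j < H)%N -> `|\sum_(t < T) cos_turns (j%:R * g t)| <= T%:R / H%:R) ->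
  (forall t : 'I_T, t \in A -> exists i : int, `|g t - i%:~R| <= (16 * H%:R)^-1) ->
  #|A|%:R * H%:R <= 8 * T%:R :> R.
Proof.
move=> H0 sums close; have H0r : 0 < H%:R :> R by rewrite ltr0n.
pose F (t : 'I_T) : R := (\sum_(j < H) cos_turns (j%:R * g t)) ^+ 2
   + (\sum_(j < H) sin_turns (j%:R * g t)) ^+ 2.
have F0 t : 0 <= F t by rewrite addr_ge0 ?sqr_ge0.
have F_large t : t \in A -> H%:R ^+ 2 / 4 <= F t.
  move=> /close[i gi].
  have half (j : 'I_H) : 1 / 2 <= cos_turns (j%:R * g t).
    rewrite -(cos_turns_int _ (j%:Z * i)) intrM -mulrBr.
    have := cos_turns_lipschitz (j%:R * (g t - i%:~R)) 0.
    rewrite /cos_turns mulr0 cos0 subr0 normrM (ger0_norm (ler0n _ _)).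
    have : j%:R * `|g t - i%:~R| <= 1 / 16.
      have -> : 1 / 16 = H%:R * (16 * H%:R)^-1 :> R by field; rewrite gt_eqF.
      by apply: ler_pM => //; rewrite ler_nat ltnW.
    by rewrite ler_norml => ? /andP[? ?]; lra.
  apply: le_trans (_ : (\sum_(j < H) cos_turns (j%:R * g t)) ^+ 2 <= _); last first.
    by rewrite lerDl sqr_ge0.
  have -> : H%:R ^+ 2 / 4 = (\sum_(j < H) (1 / 2)) ^+ 2 :> R.
    by rewrite sumr_const card_ord -(mulr_natl (1 / 2)); field.
  have le_S : \sum_(j < H) (1 / 2) <= \sum_(j < H) cos_turns (j%:R * g t) by apply: ler_sum.
  have S0 : 0 <= \sum_(j < H) (1 / 2) :> R by apply: sumr_ge0 => j _; rewrite divr_ge0.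
  by rewrite ler_pXn2r ?nnegrE // (le_trans S0).
have FE t : F t = \sum_(j < H) \sum_(l < H) cos_turns ((j%:R - l%:R) * g t).
  rewrite /F !expr2 !big_distrlr -big_split /=; apply: eq_bigr => j _.
  by rewrite -big_split /=; apply: eq_bigr => l _; rewrite mulrBl cos_turnsB.
have corr (j l : 'I_H) : j != l -> `|\sum_(t < T) cos_turns ((j%:R - l%:R) * g t)| <= T%:R / H%:R.
  wlog lt : j l / (l < j)%N.
    move=> wl neq; have [lt|ge] := ltnP l j; first exact: wl.
    rewrite (eq_bigr (fun t : 'I_T => cos_turns ((l%:R - j%:R) * g t))).
      by apply: wl; rewrite 1?eq_sym // ltn_neqAle ge andbT.
    by move=> t _; rewrite -cos_turnsN -mulNr opprB.
  move=> _; have := sums (j - l)%N; rewrite natrB; last exact: ltnW.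
  by apply; rewrite subn_gt0 lt /=; apply: leq_ltn_trans (ltn_ord j); rewrite leq_subr.
have upper : \sum_(t < T) F t <= H%:R * (T%:R + H%:R * (T%:R / H%:R)).
  rewrite (eq_bigr _ (fun t _ => FE t)) exchange_big /=.
  under eq_bigr => j _ do rewrite exchange_big /=.
  apply: (le_trans (ler_norm _)); apply: norm_sum_le => j.
  rewrite (bigD1 j) //=; apply: le_trans (ler_normD _ _) _; apply: lerD.
    by rewrite -[leRHS]mulr1; apply: norm_sum_le => t; apply: cos_turns_le1.
  apply: le_trans (ler_norm_sum _ _ _) _.
  apply: le_trans (_ : \sum_(l < H) T%:R / H%:R <= _).
    rewrite big_mkcond; apply: ler_sum => l _; case: ifP => [neq|_].
      by apply: corr; rewrite eq_sym.
    by rewrite divr_ge0.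
  by rewrite sumr_const card_ord -(mulr_natl (_ / _)).
have lower : #|A|%:R * (H%:R ^+ 2 / 4) <= \sum_(t < T) F t.
  rewrite mulr_natl -sumr_const big_mkcond; apply: ler_sum => t _.
  by case: ifP => // /F_large.
have := le_trans lower upper; rewrite (mulrC H%:R (T%:R / H%:R)) divfK ?gt_eqF //.
rewrite (_ : #|A|%:R * _ = H%:R * (#|A|%:R * H%:R / 4)); last by field.
by rewrite ler_pM2l //; lra.
Qed.

Lemma iter_fdiff_inv (R : realType) (x M : R) m t : 0 < x -> 0 <= M ->
  iter m (@fdiff R) (fun t => (x + M * t%:R)^-1) t =
  (-1) ^+ m * m`!%:R * M ^+ m * (\prod_(i < m.+1) (x + M * (t + i)%:R))^-1.
Proof.
move=> x0 M0; have d0 i : x + M * i%:R != 0.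
  by rewrite gt_eqF // ltr_wpDr // mulr_ge0.
have p0 a m' : \prod_(i < m') (x + M * (a + i)%:R) != 0 by apply/prodf_neq0 => i _.
elim: m t => [|m IH] t; first by rewrite big_ord_recl big_ord0 addn0 mulr1 fact0 !expr0 !mul1r.
rewrite iterS {1}/fdiff !IH.
set P := \prod_(i < m.+1) (x + M * (t + i)%:R).
have PE : \prod_(i < m.+1) (x + M * (t + i)%:R) =
    (x + M * t%:R) * \prod_(i < m) (x + M * (t.+1 + i)%:R).
  by rewrite big_ord_recl addn0; congr (_ * _); apply: eq_bigr => i _; rewrite /= addSnnS.
rewrite /P PE (big_ord_recr m.+1) PE (big_ord_recr m) /= factS natrM exprS -addSnnS.
move: (p0 t.+1 m) (d0 t) (d0 (t.+1 + m)%N).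
set Q := \prod_(i < m) _ => Q0 dt0; rewrite natrD -(natr1 t) -(natr1 m) => dm0.
by rewrite (exprS M); field; rewrite Q0 dt0 dm0.
Qed.

Lemma iter_fdiffZ (R : comPzRingType) m (c : R) (f : nat -> R) t :
  iter m (@fdiff R) (fun s => c * f s) t = c * iter m (@fdiff R) f t.
Proof.
elim: m t => [//|m IH] t; rewrite !iterS /fdiff -/(@fdiff R) !IH; ring.
Qed.

(** The differences of 1 / (x + M t) have sign (-1) ^ (q + 2); since the cosine is even,
  multiplying the function by (-1) ^ q makes them positive. On a range where x + M t
  varies by a factor rho only, they vary by a factor rho ^ (q + 3). *)
Lemma inverse_progression_sum (R : realType) q (rho : R) : 1 <= rho ->
  exists (K : R) (e : nat), 64 <= K /\
  forall T W (M x L N : R), (0 < W)%N -> 0 < M -> 0 < L -> 0 < N -> L <= x ->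
    (forall i, (i < q.+2 * T + q.+2)%N -> x + M * i%:R <= rho * L) ->
    let lam := N * (q.+2)`!%:R * M ^+ q.+2 / (rho * L) ^+ q.+3 in
    K * W%:R ^+ e <= lam * T%:R ^+ 2 -> lam * (K * W%:R ^+ e) <= 1 ->
    `|\sum_(t < T) cos_turns (N / (x + M * t%:R))| <= T%:R / W%:R.
Proof.
move=> rho1; have C1 : 1 <= rho ^+ q.+3 by rewrite exprn_ege1.
have [K [e [K64 _ test]]] := higher_difference_test q C1.
exists K, e; split=> // T W M x L N W0 M0 L0 N0 Lx xU lam h1 h2.
have x0 : 0 < x by apply: lt_le_trans Lx.
have rho0 : 0 < rho by lra.
have f0 : 0 < (q.+2)`!%:R :> R by rewrite ltr0n fact_gt0.
have M2 : 0 < M ^+ q.+2 by rewrite exprn_gt0.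
have U0 : 0 < (rho * L) ^+ q.+3 by rewrite exprn_gt0 // mulr_gt0.
have c0 : 0 < N * (q.+2)`!%:R * M ^+ q.+2 by apply: mulr_gt0 => //; apply: mulr_gt0.
have lam0 : 0 < lam by apply: divr_gt0.
rewrite (eq_bigr (fun t : 'I_T => cos_turns ((-1) ^+ q * N * (x + M * t%:R)^-1))); last first.
  by move=> t _; rewrite -mulrA -signr_odd; case: odd; rewrite ?mul1r // mulN1r cos_turnsN.
apply: (test T W lam (fun t => (-1) ^+ q * N * (x + M * t%:R)^-1) W0 lam0 h1 h2).
move=> t tT.
rewrite iter_fdiffZ iter_fdiff_inv ?(ltW M0) //.
set P := \prod_(i < _) _.
have d_bounds (i : 'I_q.+3) : L <= x + M * (t + i)%:R <= rho * L.
  rewrite (le_trans Lx) ?lerDl ?mulr_ge0 ?(ltW M0) //= xU //.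
  by have := ltn_ord i; move: tT; clear; lia.
have PL : L ^+ q.+3 <= P.
  rewrite -[in leLHS](card_ord q.+3) -prodr_const; apply: ler_prod => i _.
  by rewrite (ltW L0); case/andP: (d_bounds i).
have PU : P <= (rho * L) ^+ q.+3.
  rewrite -[in leRHS](card_ord q.+3) -prodr_const; apply: ler_prod => i _.
  by case/andP: (d_bounds i) => ? ->; rewrite andbT; lra.
have P0 : 0 < P by apply: lt_le_trans PL; rewrite exprn_gt0.
have -> : (-1) ^+ q * N * ((-1) ^+ q.+2 * (q.+2)`!%:R * M ^+ q.+2 / P) =
   N * (q.+2)`!%:R * M ^+ q.+2 / P.
  rewrite !(exprS (-1)) -[RHS]mul1r -[X in _ = X * _](sqrr_sign R q).
  by set s := (-1) ^+ q; set m := M ^+ _; ring.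
have -> : rho ^+ q.+3 * lam = N * (q.+2)`!%:R * M ^+ q.+2 / L ^+ q.+3.
  rewrite /lam (exprMn _ rho); field.
  by rewrite !expf_neq0 ?gt_eqF.
have L3 : 0 < L ^+ q.+3 by rewrite exprn_gt0.
by rewrite /lam !ler_pM2l // !lef_pV2 ?posrE //; apply/andP.
Qed.

Definition has_multiple (n k d : nat) : bool := [exists i : 'I_k, d %| n + i]%N.

Lemma mul_exp_le_left q a k n : (a ^ 2 <= k -> k ^ (2 * q + 3) <= n ^ 2 -> a * k ^ q.+1 <= n)%N.
Proof.
move=> ak kn; rewrite -(@leq_exp2r _ _ 2) // expnMn -expnM; apply: leq_trans kn.
by rewrite (_ : 2 * q + 3 = (q.+1 * 2).+1)%N ?expnS ?leq_mul2r ?ak ?orbT //; lia.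
Qed.

Lemma mul_exp_le_right q a k n :
  (a ^ 2 <= k -> n ^ 2 <= k ^ (2 * q + 5) -> a * n <= k ^ q.+3)%N.
Proof.
move=> ak nk; rewrite -(@leq_exp2r _ _ 2) // expnMn -expnM.
by rewrite (_ : q.+3 * 2 = (2 * q + 5).+1)%N ?expnS ?leq_mul //; lia.
Qed.

(** If d >= 16 k H has a multiple in [n, n + k), then n / d is within 1 / (16 H) of an
  integer, so such d in a progression modulo M are no more frequent than
  equidistribution predicts, up to a constant. The bounds for n place the differences of
  order q + 2 of n / d inside the admissible range, with a margin of a power of k that
  absorbs all powers of H. *)
Lemma card_progression_multiple (R : realType) q M D : (0 < M)%N -> (0 < D)%N ->
  exists c E : nat, forall k H n r Y T,
    Y = (16 * (k * H))%N -> T = (Y * D %/ M).+1 -> (0 < H)%N -> (r < M)%N -> (c * H ^ E <= k)%N ->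
    (k ^ (2 * q + 3) <= n ^ 2)%N -> (n ^ 2 <= k ^ (2 * q + 5))%N ->
    (#|[set t : 'I_T | (Y <= M * (Y %/ M + t) + r) &&
          has_multiple n k (M * (Y %/ M + t) + r)]| * H <= 8 * T)%N.
Proof.
move=> M0 D0; pose rho := ((3 * q + 8) * 2 * D)%N.
have rho0 : (0 < rho)%N by rewrite !muln_gt0 D0 addnS.
have [|K [e [K64 sum_le]]] := @inverse_progression_sum R q rho%:R.
  by rewrite -[1]/(1%:R) ler_nat.
pose Kn := (Num.truncn K).+1.
have K_le : K <= Kn%:R by apply: ltW; have /andP[] := @truncn_itv _ K ltac:(lra).
pose A0 := (Kn * (8 * rho) ^ q.+3 * ((q.+2)`! * M ^ q.+2))%N.
exists (A0 ^ 2 * M)%N, ((e + q.+3) * 2)%N => k H n r Y T YE TE H0 rM ck kn nk.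
have rho8 : (0 < (8 * rho) ^ q.+3)%N by rewrite expn_gt0 muln_gt0 rho0.
have FM0 : (0 < (q.+2)`! * M ^ q.+2)%N by rewrite muln_gt0 fact_gt0 expn_gt0 M0.
have A00 : (0 < A0)%N by rewrite /A0 muln_gt0 FM0 muln_gt0 rho8.
have a_le : ((A0 * H ^ (e + q.+3)) ^ 2 <= k)%N.
  apply: leq_trans ck; rewrite expnMn -expnM leq_mul2r; apply/orP; right.
  by rewrite -[leqLHS]muln1 leq_mul2l M0 orbT.
have kM : (M <= k)%N.
  apply: leq_trans ck; rewrite mulnAC -[leqLHS]mul1n leq_mul2r.
  by rewrite muln_gt0 !expn_gt0 A00 H0 orbT.
have k0 : (0 < k)%N by apply: leq_trans kM.
have n0 : (0 < n)%N
  by case: (posnP n) kn => // ->; rewrite exp0n // leqn0 expn_eq0 eqn0Ngt k0.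
have YD : (Y <= Y * D)%N by rewrite leq_pmulr.
have kH : (k <= k * H)%N by rewrite leq_pmulr.
have MT : (Y * D <= M * T)%N by rewrite TE (mulnC M) ltnW // ltn_ceil.
have MT' : (M * T <= Y * D + M)%N.
  by rewrite TE mulnS addnC leq_add2r (mulnC M) leq_divM.
have t0_le : (M * (Y %/ M) <= Y)%N by rewrite (mulnC M) leq_divM.
have t0_ge : (Y < M * (Y %/ M) + M)%N by rewrite addnC -mulnS (mulnC M) ltn_ceil.
(* the two numerical conditions on lam, cleared of denominators *)
have N1 : (Kn * H ^ e * (rho * (8 * k * H)) ^ q.+3 <= n * (M * T) ^ 2)%N.
  apply: leq_trans (_ : n * k ^ 2 <= _)%N; last first.
    by rewrite leq_mul2l leq_exp2r // orbC; apply/orP; left; clear -MT YE YD kH; lia.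
  have -> : (Kn * H ^ e * (rho * (8 * k * H)) ^ q.+3 =
      Kn * (8 * rho) ^ q.+3 * H ^ (e + q.+3) * k ^ q.+1 * k ^ 2)%N.
    have -> : (rho * (8 * k * H) = 8 * rho * H * k)%N by ring.
    rewrite (expnMn _ k) (expnMn _ H) -[in RHS]mulnA -expnD addn2 (expnD H e).
    by move: ((8 * rho) ^ _)%N (H ^ q.+3)%N (H ^ e)%N (k ^ _)%N => *; ring.
  rewrite leq_mul2r; apply/orP; right; apply: mul_exp_le_left kn.
  apply: leq_trans a_le; rewrite leq_exp2r // leq_mul2r /A0.
  by rewrite leq_pmulr ?orbT.
have N2 : (H * n * ((q.+2)`! * M ^ q.+2) * (Kn * H ^ e) <= (rho * (8 * k * H)) ^ q.+3)%N.
  apply: leq_trans (_ : k ^ q.+3 <= _)%N; last first.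
    rewrite leq_exp2r //; apply: leq_trans (_ : 8 * k * H <= _)%N; last by rewrite leq_pmull.
    by clear -kH; rewrite -mulnA; lia.
  have -> : (H * n * ((q.+2)`! * M ^ q.+2) * (Kn * H ^ e) =
     Kn * ((q.+2)`! * M ^ q.+2) * H ^ e.+1 * n)%N.
    by rewrite (expnS H); move: ((q.+2)`! * _)%N (H ^ e)%N => *; ring.
  apply: mul_exp_le_right nk; apply: leq_trans a_le; rewrite leq_exp2r //.
  apply: leq_mul; last by rewrite leq_pexp2l //; clear; lia.
  by rewrite /A0 -mulnA leq_mul2l leq_pmull ?orbT.
pose x : R := (M * (Y %/ M) + r)%:R.
pose L : R := (8 * k * H)%:R.
have M0r : 0 < M%:R :> R by rewrite ltr0n.
have L0 : 0 < L by rewrite ltr0n !muln_gt0 k0.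
have Lx : L <= x by rewrite ler_nat; clear -t0_ge kM kH YE; lia.
have xU i : (i < q.+2 * T + q.+2)%N -> x + M%:R * i%:R <= rho%:R * L.
  move=> i_lt; rewrite -!natrM -natrD ler_nat.
  have i_lt' : (M * i <= M * (q.+2 * T + q.+2))%N by rewrite leq_mul2l (ltnW i_lt) orbT.
  apply: leq_trans (_ : Y + M + (q.+2 * (Y * D + M) + M * q.+2) <= _)%N.
    rewrite mulnDr (mulnCA M) in i_lt'.
    have := leq_mul (leqnn q.+2) MT'; clear -i_lt' rM t0_le; lia.
  have MY : (M <= Y * D)%N by apply: leq_trans YD; clear -YE kH kM; lia.
  have -> : (rho * (8 * k * H) = (3 * q + 8) * (Y * D))%N by rewrite /rho YE; ring.
  by clear -MY YD; nia.
have n0r : 0 < n%:R :> R by rewrite ltr0n.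
have N1r : Kn%:R * H%:R ^+ e * (rho%:R * L) ^+ q.+3 <= n%:R * (M%:R * T%:R) ^+ 2.
  by rewrite /L -!(natrM, natrX) ler_nat.
have N2r : H%:R * n%:R * ((q.+2)`!%:R * M%:R ^+ q.+2) * (Kn%:R * H%:R ^+ e)
    <= (rho%:R * L) ^+ q.+3 by rewrite /L -!(natrM, natrX) ler_nat.
rewrite -(ler_nat R) !natrM.
apply: (card_close_to_integer (g := fun t => n%:R / (x + M%:R * t%:R))) => // [j /andP[j0 jH]|t].
  under eq_bigr do rewrite mulrA.
  have j0r : 0 < j%:R :> R by rewrite ltr0n.
  have j1r : 1 <= j%:R :> R by rewrite -[1]/(1%:R) ler_nat.
  have U0 : 0 < (rho%:R * L) ^+ q.+3 by rewrite exprn_gt0 // mulr_gt0 // ltr0n.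
  apply: (sum_le T H M%:R x L (j%:R * n%:R)) => //; first by rewrite mulr_gt0.
    apply: le_trans (_ : Kn%:R * H%:R ^+ e <= _); first by rewrite ler_wpM2r // exprn_ge0.
    rewrite mulrAC ler_pdivlMr //.
    apply: le_trans N1r _.
    rewrite [leRHS](_ : _ = (j%:R * ((q.+2)`!%:R * M%:R ^+ q)) * (n%:R * (M%:R * T%:R) ^+ 2)).
      rewrite ler_peMl //; first by rewrite mulr_ge0 ?sqr_ge0.
      by rewrite -!natrX -!natrM -[1]/(1%:R) ler_nat !muln_gt0 j0 fact_gt0 expn_gt0 M0.
    by rewrite !exprS; ring.
  rewrite mulrAC ler_pdivrMr // mul1r.
  apply: le_trans N2r.
  have F0 : 0 <= (q.+2)`!%:R * M%:R ^+ q.+2 :> R by rewrite -natrX -natrM.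
  have E0 : 0 <= H%:R ^+ e :> R by rewrite -natrX.
  rewrite -(mulrA (_ * n%:R)); apply: ler_pM.
  - by apply: mulr_ge0 => //; apply: mulr_ge0; [rewrite ltW|lra].
  - by apply: mulr_ge0 => //; lra.
  - by apply: ler_wpM2r => //; apply: ler_wpM2r; [exact: ltW|rewrite ler_nat ltnW].
  - by apply: ler_wpM2r.
rewrite inE => /andP[le_d /existsP[i /dvdnP[m def_m]]].
set d := (M * (Y %/ M + t) + r)%N in le_d def_m.
have -> : x + M%:R * t%:R = d%:R by rewrite /x /d -natrM -natrD; congr _%:R; ring.
have d0 : 0 < d%:R :> R by rewrite ltr0n (leq_trans _ le_d) // YE !muln_gt0 k0.
exists m.
have -> : n%:R / d%:R - m%:~R = - (i%:R / d%:R) :> R.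
  rewrite -[m%:~R]/(m%:R); have : (n + i)%:R = (m * d)%:R :> R by rewrite def_m.
  rewrite natrD natrM => /(canRL (addrK _)) ->; field; exact: lt0r_neq0.
rewrite normrN ger0_norm ?divr_ge0 //.
rewrite ler_pdivrMr // mulrC -ler_pdivrMr ?invr_gt0 ?mulr_gt0 ?ltr0n // invrK -!natrM ler_nat.
by apply: leq_trans le_d; rewrite YE; have := ltn_ord i; clear -H0; nia.
Qed.

(** * Residue classes prime to a highly divisible modulus *)

Definition supported (ps : seq nat) (n : nat) : bool := (0 < n)%N && all (mem ps) (primes n).

Lemma sum_multiples_le (R : realType) (p N : nat) (F : nat -> R) : (0 < p)%N ->
  (forall n, 0 <= F n) ->
  \sum_(n < N.+1 | (p %| n)%N) F n <= \sum_(m < N.+1) F (p * m)%N.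
Proof.
move=> p0 F0.
apply: le_trans (_ : \sum_(n < N.+1) \sum_(m < N.+1 | n == (p * m)%N :> nat) F n <= _).
  rewrite big_mkcond /=; apply: ler_sum => n _; case: ifP => [/dvdnP[m def_n]|_]; last first.
    exact: sumr_ge0.
  have m_lt : (m < N.+1)%N.
    by apply: leq_ltn_trans (ltn_ord n); rewrite def_n leq_pmulr.
  rewrite (bigD1 (Ordinal m_lt)) /=; last by rewrite def_n mulnC.
  by rewrite lerDl sumr_ge0.
rewrite (exchange_big_dep xpredT) //=; apply: ler_sum => m _.
have [le|gt] := leqP (p * m) N.
  rewrite (big_pred1 (Ordinal (le : (p * m < N.+1)%N))) //.
rewrite big_pred0 // => n; apply: contraTF gt => /eqP <-.
by rewrite -leqNgt -ltnS.
Qed.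

(** Euler's argument: expanding the product of 1 / (1 - 1 / p) produces every 1 / n with n
  composed of the primes in ps. *)
Lemma sum_supported_inv_le (R : realType) (ps : seq nat) N : uniq ps -> all prime ps ->
  (\sum_(n < N.+1 | supported ps n) n%:R^-1) * \prod_(p <- ps) (1 - p%:R^-1) <= 1 :> R.
Proof.
elim: ps => [|p ps IH] /=.
  move=> _ _; rewrite big_nil mulr1.
  apply: le_trans (_ : \sum_(n < N.+1 | n == 1%N :> nat) n%:R^-1 <= _).
    rewrite big_mkcond [leRHS]big_mkcond; apply: ler_sum => n _.
    rewrite /supported; case: (nat_of_ord n) => [|[|m]] //=.
    have := prime.pdiv_prime (isT : 1 < m.+2)%N; have := pdiv_dvd m.+2 => dv pr.
    have : pdiv m.+2 \in primes m.+2 by rewrite mem_primes pr dv.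
    by case: (primes m.+2).
  case: N => [|N]; first by rewrite big_pred0 // => -[[]].
  rewrite (big_pred1 (inord 1)) /=; first by rewrite inordK // invr1.
  by move=> n; rewrite /= -val_eqE /= inordK.
move=> /andP[p_ps ups] /andP[pr prs]; rewrite big_cons.
set S' := \sum_(n < N.+1 | _) _; pose S : R := \sum_(n < N.+1 | supported ps n) n%:R^-1.
have p0r : 0 < p%:R :> R by rewrite ltr0n prime_gt0.
have p1r : p%:R^-1 <= 1 :> R by rewrite invf_le1 // -[1]/(1%:R) ler_nat prime_gt0.
have P0 : 0 <= \prod_(p <- ps) (1 - p%:R^-1) :> R.
  rewrite big_seq; apply: prodr_ge0 => l /(allP prs) l_pr.
  by rewrite subr_ge0 invf_le1 ?ltr0n ?prime_gt0 // -[1]/(1%:R) ler_nat prime_gt0.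
have step : S' <= S + p%:R^-1 * S'.
  rewrite {1}/S' (bigID (fun n : 'I_N.+1 => p %| n)%N) /= addrC; apply: lerD.
    rewrite big_mkcond /S [leRHS]big_mkcond; apply: ler_sum => n _.
    case: ifP => [/andP[/andP[n0 /allP sup] /negPf p_n]|_].
      rewrite (_ : supported ps n = true) // /supported n0; apply/allP => l l_n.
      have := sup l l_n; rewrite !inE => /orP[/eqP l_p|//].
      by move: l_n; rewrite l_p mem_primes p_n !andbF.
    by case: ifP => // _; rewrite invr_ge0.
  pose F n : R := if supported (p :: ps) n then n%:R^-1 else 0.
  have F0 n : 0 <= F n by rewrite /F; case: ifP => // _; rewrite invr_ge0.
  apply: le_trans (_ : \sum_(n < N.+1 | (p %| n)%N) F n <= _).
    rewrite big_mkcond [leRHS]big_mkcond; apply: ler_sum => n _.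
    by rewrite /F; case: supported => //=; case: ifP.
  apply: le_trans (sum_multiples_le _ _ F0) _; first exact: prime_gt0.
  rewrite /S' mulr_sumr [leRHS]big_mkcond; apply: ler_sum => m _.
  rewrite /F; case: ifP => [/andP[pm0 sup]|_].
    have m0 : (0 < m)%N by move: pm0; rewrite muln_gt0 => /andP[].
    rewrite (_ : supported (p :: ps) m = true); first by rewrite natrM invfM.
    rewrite /supported m0; apply/allP => l l_m; apply: (allP sup).
    by move: l_m; rewrite !mem_primes pm0 => /and3P[-> _ dv]; rewrite dvdn_mull.
  by case: ifP => // _; rewrite mulr_ge0 ?invr_ge0.
rewrite mulrA; apply: le_trans (IH ups prs); rewrite ler_wpM2r //.
by rewrite -[leRHS]/S mulrBr mulr1 lerBlDr (mulrC S').
Qed.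

Lemma harmonic_sum_unbounded (R : realType) (B : R) : exists N, B < \sum_(n < N.+1) n%:R^-1.
Proof.
apply: contrapT => /forallNP bounded; apply: (@dvg_harmonic R).
apply: nondecreasing_is_cvgn.
  by apply: nondecreasing_series => n *; rewrite invr_ge0.
exists B => _ [n _ <-]; have := bounded n; move/negP; rewrite -leNgt; apply: le_trans.
rewrite big_ord_recl invr0 add0r /series /= big_mkord.
by apply: ler_sum => i _; rewrite /harmonic /bump.
Qed.

(** Take M = N! with N large: all n <= N are composed of primes of M, so Euler's
  argument bounds totient M / M by the inverse of a harmonic sum. *)
Lemma totient_ratio_small (R : realType) (eta : R) : 0 < eta ->
  exists2 M, (0 < M)%N & (totient M)%:R <= eta * M%:R.
Proof.
move=> eta0; have [N H_N] := harmonic_sum_unbounded eta^-1.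
pose M := N`!; have M0 : (0 < M)%N by rewrite fact_gt0.
exists M => //.
have := @sum_supported_inv_le R (primes M) N (primes_uniq M).
have -> : all prime (primes M) by apply/allP => p; rewrite mem_primes => /and3P[].
move=> /(_ isT).
have -> : \sum_(n < N.+1 | supported (primes M) n) n%:R^-1 = \sum_(n < N.+1) n%:R^-1 :> R.
  rewrite big_mkcond; apply: eq_bigr => n _; rewrite /supported; case: posnP => [->|n0] /=.
    by rewrite invr0.
  rewrite (_ : all _ _ = true) //; apply/allP => p.
  rewrite [mem _ p]mem_primes mem_primes M0 => /and3P[-> _ dv] /=; apply: dvdn_trans dv _.
  by rewrite dvdn_fact // n0 -ltnS ltn_ord.
have -> : \prod_(p <- primes M) (1 - p%:R^-1) = (totient M)%:R / M%:R :> R.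
  have ME : M%:R = \prod_(p <- primes M) p%:R ^+ logn p M :> R.
    rewrite {1}(prod_prime_decomp M0) prime_decompE big_map /= natr_prod.
    by apply: eq_bigr => p _; rewrite natrX.
  rewrite totientE // ME natr_prod.
  rewrite -prodf_div big_seq [RHS]big_seq; apply: eq_bigr => p p_M.
  have p_pr : prime p by move: p_M; rewrite mem_primes => /andP[].
  have p0 := prime_gt0 p_pr; have v0 : (0 < logn p M)%N by rewrite logn_gt0.
  rewrite -(prednK v0) exprS !natrM -subn1 natrB // natrX.
  by field; rewrite expf_neq0 !pnatr_eq0 -lt0n p0.
have M0r : 0 < M%:R :> R by rewrite ltr0n.
move=> le1; rewrite -ler_pdivrMr //.
rewrite -(ler_pM2l (_ : 0 < eta^-1)) ?invr_gt0 // mulVf ?gt_eqF //.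
apply: le_trans le1; rewrite ler_wpM2r ?divr_ge0 //; exact: ltW.
Qed.

(** The primes above M lie in the totient M residue classes prime to M, and each class
  contributes what equidistribution allows. *)
Lemma card_primes_multiple (R : realType) q M D : (0 < M)%N -> (0 < D)%N ->
  exists c E : nat, forall k H n Y, Y = (16 * (k * H))%N -> (0 < H)%N -> (c * H ^ E <= k)%N ->
    (k ^ (2 * q + 3) <= n ^ 2)%N -> (n ^ 2 <= k ^ (2 * q + 5))%N ->
    (#|[set p : 'I_(Y * D).+1 | [&& prime p, Y <= p & has_multiple n k p]]| * M
       <= totient M * (256 * D * k))%N.
Proof.
move=> M0 D0; have [c [E progr]] := @card_progression_multiple R q M D M0 D0.
exists (c + M)%N, E => k H n Y YE H0 ck kn nk.
have HE : (0 < H ^ E)%N by rewrite expn_gt0 H0.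
have ck' : (c * H ^ E <= k)%N by apply: leq_trans ck; rewrite leq_mul2r leq_addr orbT.
have Mk : (M <= k)%N.
  by apply: leq_trans ck; rewrite mulnDl; apply: leq_trans (leq_addl _ _); rewrite leq_pmulr.
have kH : (k <= k * H)%N by rewrite leq_pmulr.
have MY : (M < Y)%N by clear -YE kH Mk M0; lia.
pose T := (Y * D %/ M).+1.
pose A := [set p : 'I_(Y * D).+1 | [&& prime p, Y <= p & has_multiple n k p]%N].
rewrite -/A; pose res (p : 'I_(Y * D).+1) : 'I_M := Ordinal (ltn_pmod p M0).
have fiber (r : 'I_M) : (#|[set p in A | res p == r]| * H <= coprime M r * (8 * T))%N.
  have [->|[p0]] := set_0Vmem [set p in A | res p == r]; first by rewrite cards0.
  rewrite !inE => /andP[/and3P[p0_pr Yp0 _] /eqP r_p0].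
  have -> : coprime M r.
    rewrite coprime_sym -r_p0 /= coprime_modl prime_coprime //.
    by apply/negP => /dvdn_leq; rewrite M0 => /(_ isT); clear -MY Yp0; lia.
  rewrite mul1n.
  apply: leq_trans (progr k H n r Y T YE erefl H0 (ltn_ord r) ck' kn nk).
  rewrite leq_mul2r; apply/orP; right.
  pose g (p : 'I_(Y * D).+1) : 'I_T := inord (p %/ M - Y %/ M).
  have gE p : p \in [set p in A | res p == r] ->
      [/\ (M * (Y %/ M + g p) + r = p)%N, (Y <= p)%N & has_multiple n k p].
    rewrite !inE => /andP[/and3P[_ Yp hp] /eqP rp]; split=> //.
    rewrite /g inordK; last first.
      rewrite ltnS; apply: leq_trans (leq_subr _ _) _; apply: leq_div2r.
      by rewrite -ltnS ltn_ord.
    by rewrite subnKC ?leq_div2r // -rp /= mulnC -divn_eq.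
  rewrite -(card_in_imset (f := g)); last first.
    move=> p1 p2 /gE[e1 _ _] /gE[e2 _ _] eq_g; apply/ord_inj.
    by rewrite -e1 -e2 eq_g.
  apply/subset_leq_card/fintype.subsetP => _ /imsetP[p /gE[ep Yp hp] ->].
  by rewrite inE ep Yp.
have count : (#|A| * H <= totient M * (8 * T))%N.
  rewrite -sum1_card (partition_big res xpredT) //= big_distrl /=.
  rewrite totient_count_coprime big_mkord big_distrl /=; apply: leq_sum => r _.
  by have := fiber r; rewrite -sum1_card; under eq_bigl do rewrite inE.
have TM : (T * M <= 2 * (Y * D))%N.
  rewrite /T mulSn mul2n -addnn; apply: leq_add; last exact: leq_divM.
  by rewrite (leq_trans (ltnW MY)) // leq_pmulr.
rewrite -(leq_pmul2r H0) mulnAC; apply: leq_trans (_ : totient M * (8 * T) * M <= _)%N.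
  by rewrite leq_mul2r count orbT.
rewrite -!mulnA leq_mul2l; apply/orP; right.
apply: leq_trans (_ : 8 * (2 * (Y * D)) <= _)%N; first by rewrite leq_mul2l TM orbT.
by rewrite YE; apply: eq_leq; ring.
Qed.

(** * Chebyshev's upper bound *)

Lemma logn_fact_widen p n N : prime p -> (n <= N)%N ->
  logn p n`! = (\sum_(1 <= i < N.+1) n %/ p ^ i)%N.
Proof.
move=> pr nN; rewrite logn_fact // (big_cat_nat (n := n.+1) (p := N.+1)) //=.
rewrite [X in (_ + X)%N]big1_seq ?addn0 // => i; rewrite mem_index_iota => /andP[_ /andP[ni _]].
by rewrite divn_small // (ltn_trans ni) // ltn_expl // prime_gt1.
Qed.

Lemma prod_primes_dvdn (s : seq nat) n : uniq s -> all prime s ->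
  all (fun p => p %| n)%N s -> (\prod_(p <- s) p %| n)%N.
Proof.
elim: s => [|p s IH] /=; first by rewrite big_nil dvd1n.
move=> /andP[ps us] /andP[pr prs] /andP[pn sn]; rewrite big_cons Gauss_dvd ?pn ?IH //.
rewrite big_seq; elim/big_ind: _ => [|x y ? ?|q qs]; first exact: coprimen1.
  by rewrite coprimeMr; apply/andP.
rewrite prime_coprime // dvdn_prime2 // ?(allP prs q qs) //.
by apply: contraNneq ps => ->.
Qed.

Lemma prod_primes_gt0 (s : seq nat) : all prime s -> (0 < \prod_(p <- s) p)%N.
Proof.
move=> prs; rewrite big_seq; elim/big_ind: _ => // [x y ? ?|p p_s].
  by rewrite muln_gt0; apply/andP.
exact: prime_gt0 (allP prs p p_s).
Qed.

(** Chebyshev's first function. *)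
Definition theta (R : realType) (N : nat) : R := \sum_(p < N.+1 | prime p) ln p%:R.

Lemma theta_mono (R : realType) (m n : nat) : (m <= n)%N -> theta R m <= theta R n.
Proof.
move=> mn; rewrite /theta (big_ord_widen_cond n.+1 prime (fun p => ln p%:R)) //.
rewrite big_mkcond [leRHS]big_mkcond; apply: ler_sum => p _.
case: ifP => [/andP[-> //]|_]; case: ifP => // /prime_gt0 p0.
by rewrite ln_ge0 // -[1]/(1%:R) ler_nat.
Qed.

Definition multinomial123 m := ('C(6 * m, m) * 'C(5 * m, 2 * m))%N.

Lemma multinomial123_fact m :
  (multinomial123 m * (m`! * (2 * m)`! * (3 * m)`!) = (6 * m)`!)%N.
Proof.
have h1 := @bin_fact (6 * m) m ltac:(lia); have h2 := @bin_fact (5 * m) (2 * m) ltac:(lia).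
rewrite (_ : 6 * m - m = 5 * m)%N in h1; last by lia.
rewrite (_ : 5 * m - 2 * m = 3 * m)%N in h2; last by lia.
by rewrite /multinomial123 -h1 -h2; ring.
Qed.

(** The multinomial theorem for (1 + 2 + 3) ^ (6 m). *)
Lemma multinomial123_le m : (multinomial123 m <= (2 ^ 4 * 3 ^ 3) ^ m)%N.
Proof.
have h1 : ('C(6 * m, m) * 5 ^ (5 * m) <= 6 ^ (6 * m))%N.
  rewrite [leqRHS](expnDn 5 1 (6 * m)).
  have lt : (m < (6 * m).+1)%N by lia.
  rewrite (bigD1 (Ordinal lt)) //= exp1n muln1 (_ : 6 * m - m = 5 * m)%N ?leq_addr //; lia.
have h2 : ('C(5 * m, 2 * m) * (3 ^ (3 * m) * 2 ^ (2 * m)) <= 5 ^ (5 * m))%N.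
  rewrite [leqRHS](expnDn 3 2 (5 * m)).
  have lt : (2 * m < (5 * m).+1)%N by lia.
  rewrite (bigD1 (Ordinal lt)) //= (_ : 5 * m - 2 * m = 3 * m)%N ?leq_addr //; lia.
have pos : (0 < 3 ^ (3 * m) * 2 ^ (2 * m))%N by rewrite muln_gt0 !expn_gt0.
rewrite -(leq_pmul2r pos); apply: leq_trans (_ : 6 ^ (6 * m) <= _)%N.
  by apply: leq_trans h1; rewrite /multinomial123 -mulnA leq_mul2l h2 orbT.
by rewrite !expnM -!expnMn; apply: eq_leq; congr (_ ^ _)%N.
Qed.

(** Legendre's formula: floor (6 y) - floor (3 y) - floor (2 y) - floor y is never
  negative at y = m / p ^ i, and it is positive when 1 <= 6 y < 6, as happens for i = 1.
  *)
Lemma prime_dvd_multinomial123 m p : prime p -> (m < p <= 6 * m)%N ->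
  (p %| multinomial123 m)%N.
Proof.
move=> pr /andP[mp p6]; have p0 := prime_gt0 pr.
have eq := congr1 (logn p) (multinomial123_fact m).
have mult0 : (0 < multinomial123 m)%N by rewrite muln_gt0 !bin_gt0; lia.
move: (multinomial123 m) eq mult0 => C eq C0.
rewrite !lognM ?muln_gt0 ?fact_gt0 // in eq.
rewrite (@logn_fact_widen p m (6 * m)) ?(@logn_fact_widen p (2 * m) (6 * m))
  ?(@logn_fact_widen p (3 * m) (6 * m)) ?(@logn_fact_widen p (6 * m) (6 * m)) // in eq; try lia.
suff lt : (\sum_(1 <= i < (6 * m).+1) m %/ p ^ i + \sum_(1 <= i < (6 * m).+1) (2 * m) %/ p ^ i
   + \sum_(1 <= i < (6 * m).+1) (3 * m) %/ p ^ i < \sum_(1 <= i < (6 * m).+1) (6 * m) %/ p ^ i)%N.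
  have : (0 < logn p C)%N by move: lt; rewrite -eq -[ltnLHS]add0n ltn_add2r.
  by rewrite logn_gt0 mem_primes => /and3P[].
rewrite -!big_split /= !(@big_ltn _ _ _ 1) ?expn1; try lia.
rewrite -addSn; apply: leq_add.
  rewrite (divn_small mp) add0n.
  have := leq_divM (2 * m) p; have := leq_divM (3 * m) p.
  have := ltn_ceil (6 * m) p0.
  set a := (_ %/ p)%N; set b := (2 * m %/ p)%N; set c := (3 * m %/ p)%N.
  move=> h6 h3 h2.
  have : (1 <= a)%N by rewrite divn_gt0.
  have b3 : (b < 2)%N by rewrite ltn_divLR //; lia.
  have c3 : (c < 3)%N by rewrite ltn_divLR //; lia.
  have : (3 * b <= a)%N by rewrite leq_divRL //; lia.
  have : (2 * c <= a)%N by rewrite leq_divRL //; lia.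
  by move: b3 c3; clear; lia.
apply: leq_sum => i _; have pi0 : (0 < p ^ i)%N by rewrite expn_gt0 p0.
rewrite leq_divRL // !mulnDl.
have := leq_divM m (p ^ i); have := leq_divM (2 * m) (p ^ i).
by have := leq_divM (3 * m) (p ^ i); lia.
Qed.

(** Here 2 ^ 4 3 ^ 3 = 432, and 1.1 ^ 64 > 432 is checked by repeated squaring with
  rounding. *)
Lemma ln432_le (R : realType) : ln (2 ^+ 4 * 3 ^+ 3) <= 64 / 10 :> R.
Proof.
rewrite -[leRHS]expRK ler_ln ?posrE ?expR_gt0 ?mulr_gt0 ?exprn_gt0 //.
have -> : 64 / 10 = 64 * (1 / 10) :> R by field.
rewrite expRM_natl.
have e1 : 11 / 10 <= expR (1 / 10) :> R by apply: le_trans (expR_ge1Dx _); lra.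
have e8 : 214 / 100 <= expR (1 / 10) ^+ 8 :> R.
  by apply: le_trans (_ : (11 / 10) ^+ 8 <= _); [lra|rewrite lerXn2r ?nnegrE ?expR_ge0 //; lra].
have sq (a b : R) n : 0 <= a -> a <= expR (1 / 10) ^+ n -> b <= a ^+ 2 ->
    b <= expR (1 / 10) ^+ (n * 2).
  by move=> a0 an; move/le_trans; apply; rewrite exprM lerXn2r ?nnegrE ?exprn_ge0 ?expR_ge0.
have e16 : 457 / 100 <= expR (1 / 10) ^+ (8 * 2) :> R.
  by apply: sq e8 _; clear; lra.
have e32 : 208 / 10 <= expR (1 / 10) ^+ (16 * 2) :> R.
  by apply: sq e16 _; clear; lra.
have e64 : 432 <= expR (1 / 10) ^+ (32 * 2) :> R.
  by apply: sq e32 _; clear; lra.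
by apply: le_trans e64; clear; lra.
Qed.

Lemma theta_step (R : realType) m : theta R (6 * m) <= theta R m + 64 / 10 * m%:R.
Proof.
have [->|m0] := posnP m; first by rewrite muln0 mulr0 addr0.
pose s := [seq p <- iota m.+1 (5 * m) | prime p].
have -> : theta R (6 * m) = theta R m + ln (\prod_(p <- s) p)%:R.
  have -> : ln (\prod_(p <- s) p)%:R = \sum_(p <- s) ln p%:R :> R.
    rewrite /s; elim: (iota _ _) => [|p l IH] /=; first by rewrite !big_nil ln1.
    case: ifP => // pr; rewrite !big_cons natrM lnM ?IH // posrE ltr0n.
      exact: prime_gt0.
    by rewrite prod_primes_gt0 ?filter_all.
  rewrite /theta -!(big_mkord (fun p => prime p) (fun p => ln p%:R)).
  rewrite (@big_cat_nat _ _ _ m.+1 _ (6 * m).+1) //=; last by lia.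
  by rewrite /s big_filter /index_iota (_ : (6 * m).+1 - m.+1 = 5 * m)%N //; lia.
rewrite lerD2l; apply: le_trans (_ : ln ((2 ^ 4 * 3 ^ 3) ^ m)%:R <= _).
  rewrite ler_ln ?posrE ?ltr0n ?expn_gt0 //.
    rewrite ler_nat; apply: leq_trans (multinomial123_le m).
    apply: dvdn_leq; first by rewrite muln_gt0 !bin_gt0; lia.
    apply: prod_primes_dvdn; rewrite ?filter_uniq ?iota_uniq ?filter_all //.
    apply/allP => p; rewrite mem_filter mem_iota => /andP[pr ?].
    by apply: prime_dvd_multinomial123 => //; lia.
  by rewrite prod_primes_gt0 ?filter_all.
rewrite natrX lnXn; last by rewrite ltr0n.
by rewrite -(mulr_natr (ln _) m) ler_wpM2r // natrM !natrX ln432_le.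
Qed.

(** Iterating theta (6 m) <= theta m + 6.4 m gives the slope 6.4 / 5 = 1.28; the excess
  of 1.3 over it absorbs the rounding of x / 6 from x = 501 on. *)
Lemma theta_le (R : realType) : exists B : R, 0 <= B /\
  forall x, theta R x <= 13 / 10 * x%:R + B.
Proof.
exists (theta R 500); split.
  by apply: sumr_ge0 => p pr; rewrite ln_ge0 // -[1]/(1%:R) ler_nat prime_gt0.
elim/ltn_ind => x IH; have [le|gt] := leqP x 500.
  by rewrite (le_trans (theta_mono R le)) // lerDr mulr_ge0 // divr_ge0.
pose m := (x %/ 6).+1; have m_lt : (m < x)%N by rewrite /m; lia.
apply: le_trans (_ : theta R (6 * m) <= _); first by apply: theta_mono; rewrite /m; lia.
apply: le_trans (theta_step R m) _; have := IH m m_lt.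
have : (6 * m <= x + 6)%N by rewrite /m; lia.
rewrite -(ler_nat R) natrM natrD.
have : 501%:R <= x%:R :> R by rewrite ler_nat.
lra.
Qed.

(** * Large n: radicals of consecutive triples *)

Lemma prime_multiple_le n k p : (0 < n)%N -> prime p -> has_multiple n k p ->
  (p <= max_pdiv_consecutive n k)%N.
Proof.
move=> n0 pr /existsP[i dv]; apply: max_pdiv_max.
rewrite mem_primes pr /=; apply/andP; split.
  by rewrite prodn_gt0 // => j; rewrite addn_gt0 n0.
rewrite big_mkord (bigD1 i) //=; exact: dvdn_mulr.
Qed.

Lemma count_multiples n k p : (0 < p)%N ->
  (\sum_(j < k) (p %| n.+1 + j) + n %/ p = (n + k) %/ p)%N.
Proof.
move=> p0; elim: k => [|k IH]; first by rewrite big_ord0 addn0.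
by rewrite big_ord_recr /= addnS divnS // -IH addSn; ring.
Qed.

Lemma count_multiples_le n k p : (0 < n)%N -> (0 < p)%N ->
  (\sum_(j < k) (p %| n + j) <= \sum_(j < k) (p %| j.+1) + 1)%N.
Proof.
case: n => // n _ p0; have := count_multiples n k p0; have := count_multiples 0 k p0.
rewrite div0n addn0 add0n => ->; have := leq_divDl p n k.
by move=> *; lia.
Qed.

Lemma ln_radical (R : realType) x N : (0 < x)%N -> (forall p, prime p -> p %| x -> p <= N)%N ->
  ln (radical x)%:R = \sum_(p < N.+1 | prime p) (p %| x)%:R * ln p%:R :> R.
Proof.
move=> x0 xN; have -> : ln (radical x)%:R = \sum_(p <- primes x) ln p%:R :> R.
  rewrite /radical; have : all prime (primes x) by apply/allP => p; rewrite mem_primes => /andP[].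
  elim: (primes x) => [|p s IH] /=; first by rewrite !big_nil ln1.
  move=> /andP[pr prs]; rewrite !big_cons natrM lnM ?IH // posrE ltr0n.
    exact: prime_gt0.
  exact: prod_primes_gt0.
rewrite (perm_big [seq p <- index_iota 0 N.+1 | (p %| x) && prime p]%N); last first.
  apply: uniq_perm; [exact: primes_uniq|exact/filter_uniq/iota_uniq|move=> p].
  rewrite mem_primes mem_filter mem_index_iota x0 ltnS /= andbC.
  apply/andP/andP => [[dv pr]|[/andP[-> ->]]] //; split; first by rewrite dv pr.
  by apply: xN => //; case/andP: dv.
rewrite big_filter big_mkord big_mkcondl; apply: eq_bigr => p _.
by case: (p %| x)%N; rewrite ?mul1r ?mul0r.
Qed.

Lemma radical_le x : (0 < x)%N -> (radical x <= x)%N.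
Proof.
move=> x0; apply: dvdn_leq => //; apply: prod_primes_dvdn; first exact: primes_uniq.
  by apply/allP => p; rewrite mem_primes => /andP[].
by apply/allP => p; rewrite mem_primes => /and3P[].
Qed.

(** Both sides count pairs (p, j) with p dividing a term, weighted by ln p; a window of k
  integers holds at most one more multiple of p than 1, 2, ..., k does. *)
Lemma sum_ln_radical_le (R : realType) n k m (t : 'I_m -> nat) :
  (0 < n)%N -> (forall i, 0 < t i)%N ->
  (forall p, prime p -> \sum_(i < m) (p %| t i) <= \sum_(j < k) (p %| n + j))%N ->
  \sum_(i < m) ln (radical (t i))%:R <= theta R (max_pdiv_consecutive n k) + k%:R * ln k%:R.
Proof.
move=> n0 t0 count; set P := max_pdiv_consecutive n k.
have tP i p : prime p -> (p %| t i)%N -> (p <= P)%N.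
  move=> pr dv; apply: prime_multiple_le => //; apply/existsP.
  have : (0 < \sum_(j < k) (p %| n + j))%N.
    by apply: leq_trans (count p pr); rewrite (bigD1 i) //= dv.
  rewrite lt0n sum_nat_eq0 negb_forall => /existsP[j] /=.
  by case dvj: (p %| n + j)%N => // _; exists j.
rewrite (eq_bigr _ (fun i _ => ln_radical R (t0 i) (tP i))) exchange_big /=.
apply: le_trans (_ : \sum_(p < P.+1 | prime p)
   (ln p%:R + (\sum_(j < k) (p %| j.+1))%N%:R * ln p%:R) <= _).
  apply: ler_sum => p pr; rewrite -mulr_suml -[X in X + _]mul1r -mulrDl.
  rewrite ler_wpM2r ?ln_ge0 -1?[1]/(1%:R) ?ler_nat ?prime_gt0 //.
  rewrite -natr_sum -natrD ler_nat; apply: leq_trans (count p pr) _.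
  by rewrite addnC; apply: count_multiples_le => //; apply: prime_gt0.
rewrite big_split /= lerD2l.
have -> : k%:R * ln k%:R = \sum_(j < k) ln k%:R :> R by rewrite sumr_const card_ord mulr_natl.
have -> : \sum_(p < P.+1 | prime p) (\sum_(j < k) (p %| j.+1))%N%:R * ln p%:R =
    \sum_(j < k) \sum_(p < P.+1 | prime p) (p %| j.+1)%:R * ln p%:R :> R.
  by rewrite exchange_big /=; apply: eq_bigr => p _; rewrite natr_sum mulr_suml.
apply: ler_sum => j _.
apply: le_trans (_ : \sum_(p < (P + j.+1).+1 | prime p) (p %| j.+1)%:R * ln p%:R <= _).
  rewrite (big_ord_widen_cond (P + j.+1).+1 prime (fun p => (p %| j.+1)%:R * ln p%:R)) ?ltnS ?leq_addr //.
  rewrite big_mkcond [leRHS]big_mkcond; apply: ler_sum => p _.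
  case: ifP => [/andP[-> //]|_]; case: ifP => // /prime_gt0 p0.
  by rewrite mulr_ge0 // ln_ge0 // -[1]/(1%:R) ler_nat.
rewrite -ln_radical // => [|p _ /dvdn_leq]; last by move=> /(_ isT); lia.
have rad0 : (0 < radical j.+1)%N.
  by apply: prod_primes_gt0; apply/allP => p; rewrite mem_primes => /andP[].
rewrite ler_ln ?posrE ?ltr0n ?ler_nat //; last by have := ltn_ord j; lia.
by apply: leq_trans (radical_le _) _ => //; apply: ltn_ord.
Qed.

(** The identity x (x + 2) + 1 = (x + 1) ^ 2 is the case of the abc conjecture that forces
  three consecutive integers to have a large radical. *)
Lemma abc_three_consecutive (R : realType) (delta : R) : abc_conjecture R -> 0 < delta ->
  exists c : R, forall x, (0 < x)%N ->
    2 * ln x%:R <= c + (1 + delta) * ln (radical (x * x.+1 * x.+2))%:R.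
Proof.
move=> abc delta0; have [C abcC] := abc delta delta0; exists (ln C) => x x0.
have := abcC 1%N (x * x.+2)%N (x.+1 ^ 2)%N isT; rewrite muln_gt0 x0 expn_gt0 /=.
have sq : (x.+1 ^ 2 = (x * x.+2).+1)%N by ring.
have cop : coprime (x * x.+2) (x.+1 ^ 2) by rewrite sq coprimenS.
rewrite !coprime1n cop => /(_ isT isT isT isT isT).
rewrite sq => /(_ (add1n _)); rewrite -sq.
have -> : radical (1 * (x * x.+2) * x.+1 ^ 2) = radical (x * x.+1 * x.+2).
  rewrite /radical (_ : primes _ = primes (x * x.+1 * x.+2)) //.
  apply/eq_primes => p; rewrite mul1n !primesM ?muln_gt0 ?x0 ?expn_gt0 //=.
  by case: (p \in primes x); case: (p \in primes x.+1); case: (p \in primes x.+2).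
set r := radical _; have r0 : (0 < r)%N.
  by apply: prod_primes_gt0; apply/allP => p; rewrite mem_primes => /andP[].
have x0r : 0 < x%:R :> R by rewrite ltr0n.
have rp : 0 < r%:R `^ (1 + delta) by rewrite powR_gt0 // ltr0n.
move=> le_C; have C0 : 0 < C.
  by rewrite -(pmulr_lgt0 _ rp); apply: lt_le_trans le_C; rewrite ltr0n expn_gt0.
have le_x : x%:R ^+ 2 <= C * r%:R `^ (1 + delta).
  by apply: le_trans le_C; rewrite -natrX ler_nat leq_exp2r.
have : ln (x%:R ^+ 2) <= ln (C * r%:R `^ (1 + delta)).
  by rewrite ler_ln ?posrE ?exprn_gt0 ?mulr_gt0.
by rewrite (lnM (C0 : C \in Num.pos) rp) ln_powR lnXn // mulr_natl.
Qed.

Lemma sum_by_threes (f : nat -> nat) m :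
  (\sum_(i < m) (f (3 * i) + f (3 * i).+1 + f (3 * i).+2) = \sum_(j < 3 * m) f j)%N.
Proof.
elim: m => [|m IH]; first by rewrite muln0 !big_ord0.
by rewrite big_ord_recr /= IH (_ : 3 * m.+1 = (3 * m).+3)%N ?big_ord_recr /= ?addnA //; lia.
Qed.

Lemma natural_above (R : realType) (X : R) : exists k0 : nat, forall k, (k0 <= k)%N ->
  (0 < k)%N /\ X <= ln (k%:R : R).
Proof.
have ex0 := expR_ge0 X; exists (Num.truncn (expR X)).+1 => k le_k.
have k0 : (0 < k)%N by apply: leq_trans le_k.
split=> //; rewrite -[X]expRK ler_ln ?posrE ?expR_gt0 ?ltr0n //.
have /andP[_ /ltW/le_trans] := truncn_itv ex0; apply.
by rewrite ler_nat.
Qed.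

(** Triples of consecutive integers have radical n ^ (2 - o(1)) under abc; as
  2/3 > 13/10 * 1/2, their primes cannot all stay below (k log n) / 2. *)
Lemma large_range (R : realType) : abc_conjecture R ->
  exists k1 : nat, forall k n : nat, (k1 <= k)%N -> (0 < n)%N ->
    1000 * ln (k%:R : R) <= ln (n%:R : R) ->
    1 / 2 * k%:R * ln (n%:R : R) <= (max_pdiv_consecutive n k)%:R.
Proof.
move=> abc; have [|c abc3] := abc_three_consecutive (delta := 1 / 200) abc; first lra.
have [B [B0 thetaB]] := theta_le R.
have [k0 k0P] := natural_above (`|c| + B + 1).
exists (k0 + 1000)%N => k n kk n0 nk.
have [kpos kln] := k0P k ltac:(lia).
set P := max_pdiv_consecutive n k; set L := ln n%:R in nk *.
pose m := (k %/ 3)%N.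
pose t (i : 'I_m) := ((n + 3 * i) * (n + 3 * i).+1 * (n + 3 * i).+2)%N.
have n3 i : (0 < n + 3 * i)%N by rewrite addn_gt0 n0.
have t0 i : (0 < t i)%N by rewrite !muln_gt0 n3.
have count p : prime p -> (\sum_(i < m) (p %| t i) <= \sum_(j < k) (p %| n + j))%N.
  move=> pr; apply: leq_trans (_ : \sum_(j < 3 * m) (p %| n + j) <= _)%N; last first.
    rewrite (big_ord_widen k (fun j => (p %| n + j : nat)%N)); last by rewrite mulnC leq_divM.
    by rewrite big_mkcond; apply: leq_sum => j _; case: ifP.
  rewrite -(sum_by_threes (fun j => (p %| n + j : nat)%N)); apply: leq_sum => i _.
  rewrite /t !Euclid_dvdM // !addnS.
  by case: (p %| _)%N; case: (p %| _)%N; case: (p %| _)%N.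
have upper := sum_ln_radical_le R n0 t0 count.
have L0 : 0 <= L by rewrite ln_ge0 // -[1]/(1%:R) ler_nat.
have lower : m%:R * ((2 * L - c) * (200 / 201)) <= \sum_(i < m) ln (radical (t i))%:R.
  have -> : m%:R * ((2 * L - c) * (200 / 201)) = \sum_(i < m) (2 * L - c) * (200 / 201).
    by rewrite sumr_const card_ord mulr_natl.
  apply: ler_sum => i _; have := abc3 _ (n3 i); rewrite -/(t i).
  have : L <= ln (n + 3 * i)%:R.
    by rewrite ler_ln ?posrE ?ltr0n // ler_nat leq_addr.
  by clear; lra.
have := thetaB P; rewrite -/P in upper; set S := \sum_(i < m) _ in upper lower.
set th := theta R P in upper *; set lk := ln k%:R in nk kln upper.
have m_ge : (1 / 3 - 1 / 1000) * k%:R <= m%:R :> R.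
  have km : k%:R <= 3 * m%:R + 2 :> R by rewrite -natrM -natrD ler_nat /m; lia.
  have k1000 : 1000 <= k%:R :> R by rewrite ler_nat; lia.
  by clear -km k1000; lra.
have m0 : 0 <= m%:R :> R by [].
have k1 : 1 <= k%:R :> R by rewrite -[1]/(1%:R) ler_nat.
have c_le : c <= `|c| := ler_norm c.
have cL : c <= L / 1000 by have := normr_ge0 c; clear -c_le nk kln B0; lra.
have BL : B <= L / 1000 by have := normr_ge0 c; clear -c_le nk kln B0; lra.
have kL : k%:R * lk <= k%:R * L / 1000.
  by rewrite -mulrA ler_pM2l; clear -nk k1; lra.
have BkL : B <= k%:R * L / 1000.
  by apply: le_trans BL _; rewrite ler_pM2r ?invr_gt0 // ler_peMl.
have mL : (1 / 3 - 1 / 1000) * k%:R * ((2 - 1 / 1000) * L * (200 / 201)) <=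
    m%:R * ((2 * L - c) * (200 / 201)).
  apply: ler_pM => //.
  - by rewrite mulr_ge0 //; clear; lra.
  - by rewrite !mulr_ge0 //; clear; lra.
  - by clear -cL; lra.
have kL0 : 0 <= k%:R * L by rewrite mulr_ge0.
by move: mL upper lower kL BkL kL0; clear; lra.
Qed.

(** * Prime factors of binomial coefficients *)

Lemma leq_divD_bounded d a b : (0 < d)%N ->
  ((a + b) %/ d <= (d <= a + b) + (a %/ d + b %/ d))%N.
Proof.
move=> d0; have [le|gt] := leqP d (a + b); last by rewrite divn_small.
by rewrite [leqRHS]addnC; apply: leq_divDl.
Qed.

(** Kummer: a prime power dividing a binomial coefficient is at most its upper index, as
  each power p ^ i <= N contributes at most one carry. *)
Lemma prime_power_bin_le p a b : prime p -> (0 < a + b)%N ->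
  (p ^ logn p 'C(a + b, a) <= a + b)%N.
Proof.
move=> pr N0; set N := (a + b)%N; have p0 := prime_gt0 pr; have p1 := prime_gt1 pr.
have eq := congr1 (logn p) (@bin_fact N a (leq_addr _ _)).
rewrite !lognM ?muln_gt0 ?fact_gt0 ?bin_gt0 ?leq_addr // in eq.
rewrite (_ : N - a = b)%N in eq; last by rewrite /N addKn.
rewrite (@logn_fact_widen p a N) ?(@logn_fact_widen p b N) ?(@logn_fact_widen p N N)
  ?leq_addr ?leq_addl // -big_split /= in eq.
apply: leq_trans (trunc_logP p1 N0); rewrite leq_exp2l //.
rewrite -(leq_add2r (\sum_(1 <= i < N.+1) (a %/ p ^ i + b %/ p ^ i))) eq.
apply: leq_trans (_ : \sum_(1 <= i < N.+1) ((p ^ i <= N) + (a %/ p ^ i + b %/ p ^ i)) <= _)%N.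
  by apply: leq_sum => i _; apply: leq_divD_bounded; rewrite expn_gt0 p0.
rewrite big_split leq_add2r /=.
apply: leq_trans (_ : \sum_(1 <= i < (maxn N (trunc_log p N)).+1) (i <= trunc_log p N) <= _)%N.
  rewrite [leqRHS](@big_cat_nat _ _ _ N.+1) //= ?ltnS ?leq_maxl //.
  apply: leq_trans (leq_addr _ _); rewrite !big_nat; apply: leq_sum => i /andP[i1 iN].
  by have [le|//] := boolP (p ^ i <= N)%N; rewrite (trunc_log_max p1 le).
rewrite (@big_cat_nat _ _ _ (trunc_log p N).+1) //= ?ltnS ?leq_maxr //.
rewrite [X in (_ + X)%N]big1_seq ?addn0 => [|i]; last first.
  by rewrite mem_index_iota => /andP[_ /andP[gt _]]; rewrite leqNgt gt.
rewrite big_nat (eq_bigr (fun => 1%N)) => [|i /andP[_ ]]; last by rewrite ltnS => ->.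
by rewrite -big_nat sum_nat_const_nat subn1 muln1.
Qed.

Lemma bin_le_exp_primes a b : (0 < a + b)%N ->
  ('C(a + b, a) <= (a + b) ^ size (primes 'C(a + b, a)))%N.
Proof.
move=> N0; have C0 : (0 < 'C(a + b, a))%N by rewrite bin_gt0 leq_addr.
rewrite {1}(prod_prime_decomp C0) prime_decompE big_map /=.
rewrite -[size _]sum1_size big_seq; rewrite expn_sum [leqRHS]big_seq; apply: leq_prod => p.
by rewrite expn1 mem_primes => /andP[pr _]; apply: prime_power_bin_le.
Qed.

Lemma prod_consecutive_bin n k : (0 < n)%N ->
  (\prod_(i < k) (n + i) = 'C(k + n.-1, k) * k`!)%N.
Proof.
case: n => // n _ /=; elim: k => [|k IH]; first by rewrite big_ord0 bin0.
have eq := mul_bin_diag (k + n).+1 k; rewrite /= in eq.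
rewrite big_ord_recr /= IH !addSn factS (addnC n k).
by rewrite mulnC mulnA eq; ring.
Qed.

Lemma fact_le_exp k : (k`! <= k ^ k)%N.
Proof.
elim: k => // k IH; rewrite factS expnS leq_mul2l; apply/orP; right.
by apply: leq_trans IH _; case: k => // k; rewrite leq_exp2r.
Qed.

(** The binomial coefficient C(n + k - 1, k) is at least (n / k) ^ k, and each prime accounts
  for a factor of at most n + k only. *)
Lemma many_prime_factors (R : realType) n k : (8 <= n)%N -> (0 < k)%N -> (k ^ 3 < n ^ 2)%N ->
  k%:R / 4 <= (size (primes 'C(k + n.-1, k)))%:R :> R.
Proof.
move=> n8 k0 kn; have n0 : (0 < n)%N by lia.
set b := 'C(k + n.-1, k); set w := size _.
have kn' : (k <= n)%N.
  rewrite leqNgt; apply/negP => lt; move: kn; rewrite ltnNge => /negP; apply.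
  apply: leq_trans (_ : k ^ 2 <= _)%N; first by rewrite leq_exp2r // ltnW.
  by rewrite leq_pexp2l.
have h1 : (n ^ k <= k ^ k * b)%N.
  apply: leq_trans (_ : \prod_(i < k) (n + i) <= _)%N.
    by rewrite -[X in (n ^ X)%N]card_ord -prod_nat_const; apply: leq_prod => i _; apply: leq_addr.
  rewrite prod_consecutive_bin // mulnC leq_mul2r; apply/orP; right.
  exact: fact_le_exp.
have b0 : (0 < b)%N by rewrite bin_gt0 leq_addr.
have h2 : (b <= (2 * n) ^ w)%N.
  apply: leq_trans (bin_le_exp_primes _) _; first by rewrite addn_gt0 k0.
  have : (k + n.-1 <= 2 * n)%N by lia.
  by rewrite -/b -/w; case: w => // w' le; rewrite leq_exp2r.
set L := ln (n%:R : R); set lk := ln (k%:R : R); set w' := w%:R.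
have n0r : 0 < n%:R :> R by rewrite ltr0n.
have k0r : 0 < k%:R :> R by rewrite ltr0n.
have i1 : k%:R * L <= k%:R * lk + ln b%:R.
  have : ln (n ^ k)%:R <= ln (k ^ k * b)%:R :> R.
    by rewrite ler_ln ?posrE ?ltr0n ?ler_nat ?muln_gt0 ?expn_gt0 ?n0 ?k0.
  rewrite natrM !natrX lnM ?posrE ?exprn_gt0 ?ltr0n // !lnXn // -/L -/lk.
  by rewrite -(mulr_natl L) -(mulr_natl lk).
have i2 : ln b%:R <= w' * (ln 2 + L).
  have : ln b%:R <= ln ((2 * n) ^ w)%:R :> R.
    by rewrite ler_ln ?posrE ?ltr0n ?ler_nat ?expn_gt0 ?muln_gt0 ?n0.
  rewrite natrX lnXn ?ltr0n ?muln_gt0 ?n0 // natrM lnM ?posrE // -/L.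
  by rewrite -(mulr_natl (_ + _)).
have i3 : 3 * lk <= 2 * L.
  have : ln (k ^ 3)%:R <= ln (n ^ 2)%:R :> R.
    by rewrite ler_ln ?posrE ?ltr0n ?ler_nat ?expn_gt0 ?n0 ?k0 // ltnW.
  by rewrite !natrX !lnXn // -(mulr_natl L) -(mulr_natl lk).
have i4 : 3 * ln 2 <= L.
  rewrite mulr_natl -lnXn // ler_ln ?posrE ?exprn_gt0 //.
  by rewrite -natrX ler_nat.
have ln2 : 0 < ln 2 :> R by rewrite ln_gt0 // ltr1n.
have w0 : 0 <= w' by [].
have L0 : 0 < L by clear -ln2 i4; lra.
rewrite ler_pdivrMr // -(ler_pM2r L0).
have := ler_wpM2l w0 i4; have := ler_wpM2l (ltW k0r) i3.
by move: i1 i2; clear; lra.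
Qed.

(** * Moderate n: equidistribution and the sieve *)

Lemma uniform_threshold (Q : nat -> nat -> Prop) :
  (forall q, exists k0, forall k, (k0 <= k)%N -> Q q k) ->
  forall A, exists k0, forall q k, (q <= A)%N -> (k0 <= k)%N -> Q q k.
Proof.
move=> ev; elim=> [|A [k0 IH]].
  by have [k0 h] := ev 0%N; exists k0 => q k; rewrite leqn0 => /eqP ->; apply: h.
have [k1 h] := ev A.+1; exists (maxn k0 k1) => q k; rewrite geq_max leq_eqVlt.
by move=> /orP[/eqP ->|qA] /andP[? ?]; [apply: h|apply: IH].
Qed.

(** The term of order E + 1 in the exponential series of ln k bounds (ln k) ^ (E + 1) by
  a multiple of k, which leaves one factor ln k to absorb the constant. *)
Lemma log_power_le (R : realType) (c E : nat) : exists k0 : nat, forall k H : nat,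
  (k0 <= k)%N -> H%:R <= ln (k%:R : R) -> (c * H ^ E <= k)%N.
Proof.
have [k0 k0P] := natural_above ((c * (E.+1)`!)%:R : R).
exists k0 => k H /k0P[kpos ln_k] H_le.
have k0r : 0 < k%:R :> R by rewrite ltr0n.
have lk0 : 0 <= ln (k%:R : R) by rewrite ln_ge0 // -[1]/(1%:R) ler_nat.
have f0 : 0 < (E.+1)`!%:R :> R by rewrite ltr0n fact_gt0.
have pow : ln (k%:R : R) ^+ E.+1 <= (E.+1)`!%:R * k%:R.
  have := expR_ge1Dxn E lk0; rewrite lnK ?posrE // => h.
  by rewrite mulrC -ler_pdivrMr //; lra.
case: (posnP c) => [->|c0]; first by rewrite mul0n.
have lk1 : 0 < ln (k%:R : R).
  by apply: lt_le_trans ln_k; rewrite ltr0n muln_gt0 c0 fact_gt0.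
rewrite -(ler_nat R) natrM natrX.
apply: le_trans (_ : c%:R * ln (k%:R : R) ^+ E <= _).
  by rewrite ler_wpM2l // lerXn2r ?nnegrE.
rewrite -(ler_pM2r lk1) -mulrA -exprSr; apply: le_trans (ler_wpM2l (ler0n _ c) pow) _.
by rewrite mulrA mulrC ler_pM2l // -natrM.
Qed.

(** Each of the primes counted contributes at least (ln k) / 2 to theta Y. *)
Lemma card_small_primes (R : realType) (B : R) X Y k :
  (forall x, theta R x <= 13 / 10 * x%:R + B) -> (Y <= X)%N -> 0 < ln (k%:R : R) ->
  #|[set p : 'I_X.+1 | [&& prime p, (k <= p ^ 2)%N & (p < Y)%N]]|%:R * (ln (k%:R : R) / 2)
    <= 13 / 10 * Y%:R + B.
Proof.
move=> thetaB YX lk0; apply: le_trans (thetaB Y).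
rewrite /theta (big_ord_widen_cond X.+1 prime (fun p => ln p%:R)) ?ltnS //.
rewrite mulr_natl -sumr_const big_mkcond [leRHS]big_mkcond; apply: ler_sum => p _.
rewrite inE; case: ifP => [/and3P[pr kp pY]|_]; last first.
  by case: ifP => // /andP[/prime_gt0 p0 _]; rewrite ln_ge0 // -[1]/(1%:R) ler_nat.
rewrite pr ltnS (ltnW pY) ler_pdivrMr // mulr_natr -lnXn ?ltr0n ?prime_gt0 //.
have k0 : (0 < k)%N by case: k lk0 {kp} => //; rewrite ln0 // ltxx.
have kpr : k%:R <= p%:R ^+ 2 :> R by rewrite -natrX ler_nat.
have p0 : 0 < p%:R :> R by rewrite ltr0n prime_gt0.
by rewrite ler_ln ?posrE ?exprn_gt0 // ltr0n.
Qed.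

Lemma card_sqr_lt (R : realType) X k :
  #|[set p : 'I_X.+1 | (p ^ 2 < k)%N]|%:R <= k%:R / 32 + 9 :> R.
Proof.
apply: le_trans (_ : (k%:R / 32 + 8) + 1 <= _); last by lra.
apply: card_le_diameter; first by rewrite addr_ge0 // divr_ge0.
move=> t u _; rewrite inE => uk tu.
have sq (v : nat) : (32 * v <= v ^ 2 + 256)%N.
  rewrite -mulnn; have [?|?] := leqP v 16; first by nia.
  by rewrite -(subnKC (ltnW _ : 16 <= v)%N) //; move: (v - 16)%N => w; nia.
have : ((u - t) * 32 <= k + 256)%N by have := sq u; clear -uk; lia.
by rewrite -(ler_nat R) natrM natrD; lra.
Qed.

(** If all prime factors were at most C k ln k, those above 16 k H, with H a small multiple of
  ln k, would be too few by equidistribution and the sieve, and those below by Chebyshev. *)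
Lemma middle_range (R : realType) (A C : nat) : (0 < C)%N ->
  exists k1 : nat, forall k n : nat, (k1 <= k)%N -> (k ^ 3 < n ^ 2)%N -> (n <= k ^ A)%N ->
    C%:R * k%:R * ln (k%:R : R) <= (max_pdiv_consecutive n k)%:R.
Proof.
move=> C0; have [B [B0 thetaB]] := theta_le R.
pose G := 1000%N; have [D DE] : exists D, D = (G * C)%N by exists (G * C)%N.
have D0 : (0 < D)%N by rewrite DE muln_gt0 C0.
have D0r : 0 < D%:R :> R by rewrite ltr0n.
have [|M M0 totM] := @totient_ratio_small R (4096 * D%:R)^-1.
  by rewrite invr_gt0 mulr_gt0.
have M0r : 0 < M%:R :> R by rewrite ltr0n.
pose Q q k := forall n H, (0 < H)%N -> H%:R <= ln (k%:R : R) ->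
  (k ^ (2 * q + 3) <= n ^ 2)%N -> (n ^ 2 <= k ^ (2 * q + 5))%N ->
  #|[set p : 'I_(16 * (k * H) * D).+1 |
      [&& prime p, 16 * (k * H) <= p & has_multiple n k p]%N]|%:R <= k%:R / 16 :> R.
have [|kA kAP] := @uniform_threshold Q _ A.
  move=> q; have [c [E large]] := @card_primes_multiple R q M D M0 D0.
  have [k0 k0P] := log_power_le R c E; exists k0 => k k0k n H H0 Hln kn nk.
  have := large k H n _ erefl H0 (k0P k H k0k Hln) kn nk.
  rewrite -(ler_nat R) !natrM; set N := #|_|%:R => le_N.
  rewrite -(ler_pM2r M0r); apply: le_trans le_N _.
  apply: le_trans (ler_wpM2r _ totM) _; first by rewrite !mulr_ge0.
  by rewrite le_eqVlt; apply/orP; left; apply/eqP; field; rewrite gt_eqF.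
have [kB kBP] := natural_above (G%:R + 2 * B + 1 : R).
exists (kA + kB + 1000)%N => k n kk kn nA; rewrite leNgt; apply/negP => P_small.
have [kpos ln_k] := kBP k ltac:(clear -kk; lia).
have k1000 : 1000 <= k%:R :> R by rewrite ler_nat; clear -kk; lia.
set lk := ln (k%:R : R) in P_small ln_k.
have lk1 : 1 <= lk by apply: le_trans ln_k; rewrite lerDr addr_ge0 // mulr_ge0.
have n8 : (8 <= n)%N.
  rewrite leqNgt; apply/negP => n_lt; move: kn; rewrite ltnNge => /negP; apply.
  by apply: leq_trans (_ : 8 ^ 2 <= _)%N; [rewrite leq_exp2r // ltnW|clear -kk; nia].
have n0 : (0 < n)%N by apply: leq_trans n8.
(* H is within a constant factor of ln k *)
pose l := Num.truncn lk; pose H := (l %/ G)%N.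
have /andP[l_le l_gt] := truncn_itv (le_trans ler01 lk1); rewrite -/l in l_le l_gt.
have lG : (G <= l)%N.
  rewrite truncn_ge_nat; last exact: le_trans lk1.
  by apply: le_trans ln_k; rewrite -addrA lerDl addr_ge0 // mulr_ge0.
have H0 : (0 < H)%N by rewrite divn_gt0.
have HG : (H * G <= l)%N by apply: leq_divM.
have HGr : H%:R * 1000 <= lk by apply: le_trans l_le; rewrite -natrM ler_nat.
have H_le : H%:R <= lk by have := ler0n R H; clear -HGr; lra.
have l_le4 : (l.+1 <= 4 * G * H)%N.
  by have := ltn_ceil l (isT : 0 < G)%N; rewrite -/H; clear -H0 lG; nia.
pose Y := (16 * (k * H))%N; pose X := (Y * D)%N.
have YX : (Y <= X)%N by rewrite leq_pmulr.
have P_le : (max_pdiv_consecutive n k <= X)%N.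
  rewrite -(ler_nat R); apply: le_trans (ltW P_small) _.
  apply: le_trans (_ : C%:R * k%:R * (4 * G * H)%N%:R <= _).
    by rewrite ler_wpM2l ?mulr_ge0 // (le_trans (ltW l_gt)) // ler_nat.
  by rewrite -!natrM ler_nat /X /Y DE; clear; nia.
(* the exponent q for which n and k ^ (q + 2) differ by a factor of at most k ^ (1 / 2) *)
have [q [qA kq qn]] : exists q, [/\ (q <= A)%N, (k ^ (2 * q + 3) <= n ^ 2)%N
    & (n ^ 2 <= k ^ (2 * q + 5))%N].
  have ex : exists q, (n ^ 2 <= k ^ (2 * q + 5))%N.
    exists A; apply: leq_trans (_ : (k ^ A) ^ 2 <= _)%N; first by rewrite leq_exp2r.
    by rewrite -expnM leq_pexp2l // mulnC leq_addr.
  case: (ex_minnP ex) => q qn q_min; exists q; split=> //.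
    apply: q_min; apply: leq_trans (_ : (k ^ A) ^ 2 <= _)%N; first by rewrite leq_exp2r.
    by rewrite -expnM leq_pexp2l // mulnC leq_addr.
  case: q qn q_min => [|q] _ q_min; first by rewrite ltnW.
  rewrite leqNgt; apply/negP => lt; have := q_min q.
  rewrite (_ : 2 * q.+1 + 3 = 2 * q + 5)%N in lt; last by clear; lia.
  by move=> /(_ (ltnW lt)); rewrite ltnn.
have large := kAP q k qA ltac:(clear -kk; lia) n H H0 H_le kq qn.
have many := many_prime_factors R n8 kpos kn.
set b := 'C(_, _) in many; have b0 : (0 < b)%N by rewrite bin_gt0 leq_addr.
have prime_b p : p \in primes b -> [/\ prime p, has_multiple n k p & (p <= X)%N].
  rewrite mem_primes => /and3P[pr _ dv].
  have : (p %| \prod_(i < k) (n + i))%N by rewrite prod_consecutive_bin // dvdn_mulr.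
  rewrite Euclid_dvd_prod // big_has => /hasP[i _ dvi].
  have hm : has_multiple n k p by apply/existsP; exists i.
  split=> //; apply: leq_trans P_le; exact: prime_multiple_le.
pose S1 := [set p : 'I_X.+1 | (p ^ 2 < k)%N].
pose S2 := [set p : 'I_X.+1 | [&& prime p, (k <= p ^ 2)%N & (p < Y)%N]].
pose S3 := [set p : 'I_X.+1 | [&& prime p, Y <= p & has_multiple n k p]%N].
have size_le : (size (primes b) <= #|S1| + #|S2| + #|S3|)%N.
  apply: leq_trans (_ : #|S1 :|: S2 :|: S3| <= _)%N; last first.
    apply: leq_trans (leq_card_setU _ _) _; rewrite leq_add2r; exact: leq_card_setU.
  rewrite cardE -(size_map val); apply: uniq_leq_size; first exact: primes_uniq.
  move=> p /prime_b[pr hm pX]; apply/mapP.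
  exists (inord p : 'I_X.+1); last by rewrite /= inordK.
  rewrite mem_enum !inE inordK // pr hm /= andbT.
  by case: (ltnP (p ^ 2) k); case: (ltnP p Y).
have lk0 : 0 < lk by clear -lk1; lra.
have small := card_small_primes thetaB YX lk0; rewrite -/S2 -/lk in small.
have sq := card_sqr_lt R X k; rewrite -/S1 in sq.
rewrite -/Y -/X -/S3 in large.
have Bk : 2 * B <= lk by have := ler0n R G; clear -ln_k; lra.
have s2 : #|S2|%:R <= 416 / 10000 * k%:R + 1 :> R.
  rewrite -(ler_pM2r lk0); have : Y%:R <= 16 / 1000 * (k%:R * lk).
    by rewrite /Y !natrM; have := ler_wpM2l (ler0n R k) HGr; clear; lra.
  by move: small Bk; clear; lra.
move: size_le; rewrite -(ler_nat R) !natrD.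
by move: many large sq s2 k1000; clear; lra.
Qed.

(** * The greatest prime factor of a block of consecutive integers *)

Lemma cube_lt_sqr (R : realType) (k n : nat) :
  k%:R `^ (3 / 2) < (n%:R : R) -> (k ^ 3 < n ^ 2)%N.
Proof.
move=> kn; rewrite -(ltr_nat R) !natrX.
have -> : k%:R ^+ 3 = (k%:R `^ (3 / 2)) ^+ 2 :> R.
  rewrite -[RHS]powR_mulrn ?powR_ge0 // -powRrM divfK ?pnatr_eq0 //.
  by rewrite powR_mulrn.
by rewrite ltrXn2r ?nnegrE ?powR_ge0.
Qed.

Theorem theorem8p2 (R : realType) (abc : abc_conjecture R)
    (eps : R) (eps_gt0 : 0 < eps) (eps_lt_half : eps < 1 / 2) :
  exists k1 : nat, forall k n : nat,
    (k1 <= k)%N -> k%:R `^ (3 / 2) < (n%:R : R) ->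
    (1 / 2 - eps) * k%:R * ln (n%:R : R) <= (max_pdiv_consecutive n k)%:R.
Proof.
have [kl large] := large_range abc.
have [A AE] : exists A, A = 1000%N by exists 1000%N.
have [km middle] := middle_range R A (isT : 0 < 500)%N.
exists (kl + km + 1)%N => k n kk /cube_lt_sqr kn.
have k0 : (0 < k)%N by lia.
have n0 : (0 < n)%N by case: n kn => //; rewrite exp0n // ltn0.
have n0r : 0 < n%:R :> R by rewrite ltr0n.
have k0r : 0 < k%:R :> R by rewrite ltr0n.
have kL0 : 0 <= k%:R * ln (n%:R : R).
  by rewrite mulr_ge0 // ln_ge0 // -[1]/(1%:R) ler_nat.
have half : 1 / 2 * k%:R * ln (n%:R : R) <= (max_pdiv_consecutive n k)%:R.
  have [le|/ltW ge] := leP (1000 * ln (k%:R : R)) (ln (n%:R : R)).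
    by apply: large => //; lia.
  have nA : (n <= k ^ A)%N.
    rewrite -(ler_nat R) natrX -ler_ln ?posrE ?exprn_gt0 //.
    by rewrite lnXn // -(mulr_natl (ln _)) {1}AE.
  apply: le_trans (middle k n _ kn nA); last by lia.
  by have := ler_wpM2l (ltW k0r) ge; lra.
by apply: le_trans half; have := mulr_ge0 (ltW eps_gt0) kL0; lra.
Qed.
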